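(* Let $d\ge1$. Then: (1) If there is $\varepsilon>0$ such that every PACA (one- or two-sided error) with time complexity $n^\varepsilon$ can be converted into a deterministic CA with time complexity $n^d$ accepting the same language, then $\mathsf P=\mathsf{RP}$. (2) If every PACA with time complexity $\mathrm{polylog}(n)$ can be converted into a deterministic CA with time complexity $n^d$ accepting the same language, then for every $\varepsilon>0$, $\mathsf{RP}\subseteq\mathsf{TIME}[2^{n^\varepsilon}]$. (3) If there is $b>2$ such that every PACA with time complexity $(\log n)^b$ can be converted into a deterministic CA with time complexity $n^d$ accepting the same language, then for every $a\ge1$ and every $c>a/(b-1)$, $\mathsf{RTIME}[n^a]\subseteq\mathsf{TIME}[2^{O(n^c)}]$.
   Context: A (bounded, one-dimensional) cellular automaton (CA) has a finite state set $Q$, a boundary symbol $\$\notin Q$, and a local transition function $\delta\colon Q_\$\times Q\times Q_\$\to Q$ where $Q_\$=Q\cup\{\$\}$; on $s=s_0\cdots s_{n-1}\in Q^n$ the global map is $\Delta(s)=\delta(\$,s_0,s_1)\,\delta(s_0,s_1,s_2)\cdots\delta(s_{n-2},s_{n-1},\$)$. A deterministic CA as a language acceptor starts on the input word as configuration and accepts under the usual acceptance condition (a distinguished cell, e.g. the leftmost one, enters an accepting state); for time $T(n)=\Omega(n)$ this is equivalent up to constant factors to the all-cells-accept condition of a DACA. A PACA (probabilistic ACA) $C$ has a finite state set $Q$, input alphabet $\Sigma\subseteq Q$, accepting states $A\subseteq Q$ and two local transition functions $\delta_0,\delta_1$; at every step every cell independently tosses a fair coin $c$ and updates by $\delta_c$.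 A computation on $x\in\Sigma^n$ is accepting if at some step all cells are simultaneously in $A$. $C$ has time complexity $T$ if every accepting computation on an input of length $n$ first reaches $A^n$ at a step $<T(n)$; probabilities are over the coin tosses. One-sided error PACA for $L$: $x\in L\Rightarrow \Pr[\text{accept}]\ge1/2$, $x\notin L\Rightarrow\Pr[\text{accept}]=0$. Two-sided error PACA for $L$: $x\in L\Rightarrow\Pr\ge2/3$, $x\notin L\Rightarrow\Pr\le1/3$. $\mathsf{TIME}[f]$ is deterministic Turing machine time, $\mathsf{RTIME}[f]$ is the class of languages decided by probabilistic Turing machines in time $f$ with one-sided error (accept members with probability $\ge1/2$, never accept non-members), and $\mathsf{RP}=\bigcup_a\mathsf{RTIME}[n^a]$. *)

(* Defs.v *)
From Stdlib Require Import Reals ZArith.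
From mathcomp Require Import all_boot.

Set Implicit Arguments.
Unset Strict Implicit.
Unset Printing Implicit Defensive.

Delimit Scope R_scope with Re.

Definition npow (e : R) (n : nat) : R := Rpower (INR n) e.

Definition log2 (n : nat) : R := (ln (INR n) / ln 2)%Re.

Definition bigO (K : R) (f : nat -> R) : nat -> R := fun n => (K * f n + K)%Re.

(* a number of steps covering every step t with t < T n *)
Definition steps_below (T : nat -> R) (n : nat) : nat := Z.to_nat (up (T n)).

(* One step of the global map, cell i using local rule [d i];
   [None] plays the role of the boundary symbol $. *)
Definition ca_step (Q : Type) (d : nat -> option Q -> Q -> option Q -> Q)
  (s : seq Q) : seq Q :=
  map (fun p : nat * Q =>
         let (i, q) := p in
         d i (if i is k.+1 then onth s k else None) q (onth s i.+1))
      (zip (iota 0 (size s)) s).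

Record DCA (Sigma : finType) := {
  dQ : finType;
  dinp : Sigma -> dQ;
  dinp_inj : injective dinp;
  ddelta : option dQ -> dQ -> option dQ -> dQ;
  dacc : pred dQ
}.

Definition dconf (Sigma : finType) (D : DCA Sigma) (x : seq Sigma) (t : nat)
  : seq (dQ D) :=
  iter t (ca_step (fun _ => @ddelta _ D)) (map (@dinp _ D) x).

Definition dca_acc_at (Sigma : finType) (D : DCA Sigma) (x : seq Sigma) (t : nat)
  : bool :=
  if dconf D x t is q :: _ then @dacc _ D q else false.

Definition dca_time (Sigma : finType) (D : DCA Sigma) (T : nat -> R) : Prop :=
  forall x : seq Sigma, 0 < size x -> forall t, dca_acc_at D x t ->
    exists t', (INR t' < T (size x))%Re /\ dca_acc_at D x t'.

Definition dca_accepts (Sigma : finType) (D : DCA Sigma) (L : seq Sigma -> Prop)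
  : Prop :=
  forall x : seq Sigma, 0 < size x -> (L x <-> exists t, dca_acc_at D x t).

Record PACA (Sigma : finType) := {
  pQ : finType;
  pinp : Sigma -> pQ;
  pinp_inj : injective pinp;
  pdelta : bool -> option pQ -> pQ -> option pQ -> pQ;
  pacc : pred pQ
}.

Fixpoint pconf (Sigma : finType) (C : PACA Sigma) (x : seq Sigma)
  (cs : nat -> nat -> bool) (t : nat) : seq (pQ C) :=
  match t with
  | 0 => map (@pinp _ C) x
  | t'.+1 => ca_step (fun i => @pdelta _ C (cs t' i)) (pconf C x cs t')
  end.

Definition paca_acc_at (Sigma : finType) (C : PACA Sigma) (x : seq Sigma)
  (cs : nat -> nat -> bool) (t : nat) : bool :=
  all (@pacc _ C) (pconf C x cs t).

Definition paca_time (Sigma : finType) (C : PACA Sigma) (T : nat -> R) : Prop :=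
  forall (x : seq Sigma), 0 < size x -> forall cs t, paca_acc_at C x cs t ->
    exists t', (INR t' < T (size x))%Re /\ paca_acc_at C x cs t'.

Definition coins_of (N n : nat) (f : {ffun 'I_N * 'I_n -> bool})
  : nat -> nat -> bool :=
  fun t i => match insub t, insub i with
             | Some t', Some i' => f (t', i')
             | _, _ => false
             end.

Definition paca_acc_count (Sigma : finType) (C : PACA Sigma) (x : seq Sigma)
  (N : nat) : nat :=
  #|[pred f : {ffun 'I_N * 'I_(size x) -> bool} |
      [exists t : 'I_N, paca_acc_at C x (coins_of f) t]]|.

Inductive error_kind := OneSided | TwoSided.

(* C, which has time complexity T, is a PACA for L with the given error kind.
   Since acceptance only happens before step T(n), Pr[accept] is
   paca_acc_count / 2^(N*n) with N = steps_below T n. *)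
Definition paca_decides (k : error_kind) (Sigma : finType) (C : PACA Sigma)
  (T : nat -> R) (L : seq Sigma -> Prop) : Prop :=
  paca_time C T /\
  forall x : seq Sigma, 0 < size x ->
    let N := steps_below T (size x) in
    let acc := paca_acc_count C x N in
    let tot := 2 ^ (N * size x) in
    match k with
    | OneSided => (L x -> tot <= 2 * acc) /\ (~ L x -> acc = 0)
    | TwoSided => (L x -> 2 * tot <= 3 * acc) /\ (~ L x -> 3 * acc <= tot)
    end.

Definition convertible (k : error_kind) (T : nat -> R) (d : R) : Prop :=
  forall (Sigma : finType) (C : PACA Sigma) (L : seq Sigma -> Prop),
    paca_decides k C T L ->
    exists (D : DCA Sigma) (K : R),
      dca_time D (bigO K (npow d)) /\ dca_accepts D L.

Inductive move := MoveL | MoveS | MoveR.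

Definition move_Z (m : move) : Z :=
  match m with MoveL => (-1)%Z | MoveS => 0%Z | MoveR => 1%Z end.

(* A PTM with k.+1 tapes (tape 0 holds the input); at each step a fair coin
   b selects the transition function tdelta b. *)
Record PTM := {
  tQ : finType;
  tG : finType;
  tk : nat;
  tblank : tG;
  tsym : bool -> tG;
  tsym_inj : injective tsym;
  tsym_blank : forall b, tsym b != tblank;
  tq0 : tQ;
  tqacc : tQ;
  tqrej : tQ;
  tacc_rej : tqacc != tqrej;
  tdelta : bool -> tQ -> ('I_tk.+1 -> tG) ->
           tQ * ('I_tk.+1 -> tG) * ('I_tk.+1 -> move)
}.

Definition deterministic (M : PTM) : Prop :=
  forall q r, @tdelta M true q r = @tdelta M false q r.

Record tconf (M : PTM) := TConf {
  cstate : tQ M;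
  chead : 'I_(tk M).+1 -> Z;
  ctape : 'I_(tk M).+1 -> Z -> tG M
}.

Definition tinit (M : PTM) (x : seq bool) : tconf M :=
  TConf (tq0 M) (fun _ => 0%Z)
    (fun i z => if (i == ord0) && (0 <=? z)%Z && (z <? Z.of_nat (size x))%Z
                then tsym M (nth false x (Z.to_nat z)) else tblank M).

Definition thalted (M : PTM) (c : tconf M) : bool :=
  (cstate c == tqacc M) || (cstate c == tqrej M).

Definition tstep (M : PTM) (b : bool) (c : tconf M) : tconf M :=
  if thalted c then c else
  let '(q', w, m) := @tdelta M b (cstate c) (fun i => ctape c i (chead c i)) in
  TConf q' (fun i => (chead c i + move_Z (m i))%Z)
    (fun i z => if Z.eqb z (chead c i) then w i else ctape c i z).

Fixpoint trun (M : PTM) (x : seq bool) (cs : nat -> bool) (t : nat) : tconf M :=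
  match t with
  | 0 => tinit M x
  | t'.+1 => tstep (cs t') (trun M x cs t')
  end.

Definition tcoins (N : nat) (f : {ffun 'I_N -> bool}) : nat -> bool :=
  fun t => if insub t is Some t' then f t' else false.

Definition tacc_count (M : PTM) (x : seq bool) (N : nat) : nat :=
  #|[pred f : {ffun 'I_N -> bool} |
      cstate (trun M x (tcoins f) N) == tqacc M]|.

Definition thalts_within (M : PTM) (N : nat -> nat) : Prop :=
  forall x cs, thalted (trun M x cs (N (size x))).

Definition in_TIME (f : nat -> R) (L : seq bool -> Prop) : Prop :=
  exists (M : PTM) (K : R) (N : nat -> nat),
    deterministic M /\ (forall n, (INR (N n) <= bigO K f n)%Re) /\
    thalts_within M N /\
    forall x, L x <-> cstate (trun M x (fun _ => false) (N (size x))) = tqacc M.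

Definition in_RTIME (f : nat -> R) (L : seq bool -> Prop) : Prop :=
  exists (M : PTM) (K : R) (N : nat -> nat),
    (forall n, (INR (N n) <= bigO K f n)%Re) /\
    thalts_within M N /\
    forall x,
      (L x -> 2 ^ N (size x) <= 2 * tacc_count M x (N (size x))) /\
      (~ L x -> tacc_count M x (N (size x)) = 0).

Definition in_P (L : seq bool -> Prop) : Prop :=
  exists a : nat, in_TIME (fun n => INR n ^ a)%Re L.

Definition in_RP (L : seq bool -> Prop) : Prop :=
  exists a : nat, in_RTIME (fun n => INR n ^ a)%Re L.

(* Main.v *)
Require Import Defs.
From Stdlib Require Import Reals ZArith Lia Lra FunctionalExtensionality.
From HB Require Import structures.
From mathcomp Require Import all_boot.
From mathcomp Require Import zify.

Set Implicit Arguments.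
Unset Strict Implicit.
Unset Printing Implicit Defensive.

(* Padding.  Fix a deterministic machine G that sweeps back and forth over a row
   of cells and, started on a row of length n, finds a width w of the order of
   n^(p/q) (or log n for the first claim), checks that n is bounded accordingly
   in terms of w, and then counts to 2^(rho w).  The padded version of
   an input x is the word formed by all successive rows of G on x up to
   acceptance; its length N lies between 2^(rho w) and 2^(O(w)), and its first row
   spells x.  A PACA can verify such a word in time linear in the length of a row,
   because the computation of G is a local matter between consecutive rows, while
   cell 0 simulates a probabilistic machine for L on the first row.  Since w is
   large compared with n, all of this fits into the assumed sublinear bound in N.
   If the PACA has an equivalent deterministic CA running in time N^d, then a
   deterministic machine decides L by writing down the padded word of its input
   and simulating that CA, in time polynomial in N, that is, 2^(O(w)). *)

(** * Bouncing sweep machines *)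

(** The time bound of the verifier must hold on every word: one that is no history must never be
    accepted, and an accepted one must be long compared with the input it spells. No cell sees the
    length of the word, so this relation has to follow from what neighbouring cells can check; hence
    the padding is a computation that measures its own input before it may stop. Powers [n^(p/q)]
    are measured by thinning marks: [s] rounds that keep one mark in [2^q], rounding up, reduce
    [n+1] marks to one exactly when [n < 2^(q s)], and [s] rounds that keep one in [2^p], rounding
    down, spare a mark among [w] exactly when [2^(p s) <= w]. The least such [w] has the order of
    [n^(p/q)], so no arithmetic beyond finite-state sweeps occurs, and real exponents are replaced
    by rational ones. The deterministic solver can write the word because it executes the very rules
    that the cells check, and its clock reuses the [w] cells found by the measurement. *)

Record BM := {
  bQ : finType;
  bG : finType;
  bmu : bQ -> bG -> bQ * bG;
  bturn : bQ -> bQ * option bG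
}.

Definition seq_of_opt (T : Type) (o : option T) : seq T :=
  if o is Some x then [:: x] else [::].

Fixpoint pass (B : BM) (q : bQ B) (s : seq (bG B)) : bQ B * seq (bG B) :=
  if s is g :: s' then
    let p := pass (bmu q g).1 s' in (p.1, (bmu q g).2 :: p.2)
  else (q, [::]).

(* A row lists the cells in the order in which they were last written, so the
   next sweep, which runs in the opposite direction, reads its reversal. *)
Definition bstep (B : BM) (c : bQ B * seq (bG B)) : bQ B * seq (bG B) :=
  let p := pass c.1 (rev c.2) in
  ((bturn p.1).1, p.2 ++ seq_of_opt (bturn p.1).2).

Lemma pass_cat (B : BM) (q : bQ B) s1 s2 :
  pass q (s1 ++ s2) =
  ((pass (pass q s1).1 s2).1, (pass q s1).2 ++ (pass (pass q s1).1 s2).2).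
Proof. by elim: s1 q => [|g s1 IH] q /=; [case: pass | rewrite IH]. Qed.

Lemma size_pass (B : BM) (q : bQ B) s : size (pass q s).2 = size s.
Proof. by elim: s q => //= g s IH q; rewrite IH. Qed.

Lemma size_bstep (B : BM) (c : bQ B * seq (bG B)) : size c.2 <= size (bstep c).2.
Proof. by rewrite /bstep /= size_cat size_pass size_rev leq_addr. Qed.

(** * Compiling a bouncing machine to a one-tape Turing machine *)

Section Compile.

Variables (B : BM) (inp : bool -> bG B) (inp_inj : injective inp).
Variables (q0 : bQ B) (halt : bQ B -> option bool).

(** The boolean in a state is the sweep direction, and a blank marks the end of the row. An appended
    cell is written on that blank and the head stays, since the next sweep reads this cell first;
    otherwise the head steps back onto the row. *)
Definition bm_delta (_ : bool) (s : bQ B * bool + bool)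
    (r : 'I_1 -> option (bG B)) :
    (bQ B * bool + bool) * ('I_1 -> option (bG B)) * ('I_1 -> move) :=
  match s with
  | inl (q, d) =>
    match r ord0 with
    | Some g => (inl ((bmu q g).1, d), fun=> Some (bmu q g).2,
                 fun=> if d then MoveR else MoveL)
    | None => (if halt (bturn q).1 is Some b then inr b
               else inl ((bturn q).1, ~~ d),
               fun=> (bturn q).2,
               fun=> if (bturn q).2 is Some _ then MoveS
                     else if d then MoveL else MoveR)
    end
  | inr b => (inr b, r, fun=> MoveS)
  end.

Lemma bm_sym_inj : injective (fun b => Some (inp b)).
Proof. by move=> x y [] /inp_inj. Qed.

Definition tm_of_bm : PTM :=
  @Build_PTM (bQ B * bool + bool)%type (option (bG B)) 0 None
    (fun b => Some (inp b)) bm_sym_inj (fun=> isT)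
    (inl (q0, true)) (inr true) (inr false) isT bm_delta.

Definition sgz (d : bool) : Z := if d then 1%Z else (-1)%Z.

(* The cells of [L], laid out from [h] in direction [d]. *)
Definition strip (d : bool) (h : Z) (L : seq (bG B)) (z : Z) : option (bG B) :=
  let k := (sgz d * (z - h))%Z in
  if (0 <=? k)%Z then onth L (Z.to_nat k) else None.

Lemma onth_if (T : Type) (x : T) (s : seq T) i :
  onth s i = if i < size s then Some (nth x s i) else None.
Proof. by elim: s i => [|y s IH] [|i] //=; rewrite IH. Qed.

Ltac sgz_lia d := case: (d); cbv [sgz move_Z]; lia.

(** A turn leaves the tape as it is and only changes the end from which it is read. *)
Lemma strip_rev d h L :
  strip d h L =1 strip (~~ d) (h + sgz d * (Z.of_nat (size L) - 1)) (rev L).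
Proof.
move=> z; rewrite /strip.
case: L => [|x L].
  by rewrite /= !onth0n; do 2 case: ifP.
rewrite !(onth_if x) size_rev.
case: d; rewrite [sgz _]/= [sgz _]/=.
all: case: Z.leb_spec => H1; case: Z.leb_spec => H2.
all: repeat (case: ifP); rewrite //; try lia.
all: move=> H4 H3.
all: rewrite nth_rev //; congr (Some (nth _ _ _)).
all: move: (size (x :: L)) H1 H2 H3 H4 => n H1 H2 H3 H4.
all: lia.
Qed.

Definition brepr (c : tconf tm_of_bm) q d h L i :=
  [/\ cstate c = inl (q, d), chead c ord0 = (h + sgz d * Z.of_nat i)%Z
    & forall z, ctape c ord0 z = strip d h L z].

Lemma strip_at d h L i : strip d h L (h + sgz d * Z.of_nat i) = onth L i.
Proof.
rewrite /strip; case: Z.leb_spec; last by sgz_lia d.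
by move=> _; congr onth; sgz_lia d.
Qed.

Lemma strip_upd d h (L1 R : seq (bG B)) g z :
  (if Z.eqb z (h + sgz d * Z.of_nat (size L1)) then Some g
   else strip d h (L1 ++ R) z) = strip d h (L1 ++ g :: behead R) z.
Proof.
case: Z.eqb_spec => [->|ne]; first by rewrite strip_at onth_cat ltnn subnn.
rewrite /strip; case: Z.leb_spec => // H.
rewrite !onth_cat; case: ltnP => // le.
have : 0 < Z.to_nat (sgz d * (z - h)) - size L1 by move: ne H le; sgz_lia d.
by case: (_ - _) => // k _ /=; case: R; rewrite //= onth0n.
Qed.

Lemma brepr_move c q d h L1 g L2 b :
  brepr c q d h (L1 ++ g :: L2) (size L1) ->
  brepr (tstep b c) (bmu q g).1 d h (L1 ++ (bmu q g).2 :: L2) (size L1).+1.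
Proof.
case=> s1 h1 t1; rewrite /tstep /thalted s1 /=.
have r : ctape c ord0 (chead c ord0) = Some g.
  by rewrite t1 h1 strip_at onth_cat ltnn subnn.
rewrite r; split=> //=.
  by rewrite h1; sgz_lia d.
move=> z; rewrite h1 t1; exact: (strip_upd d h L1 (g :: L2)).
Qed.

Lemma brepr_pass t0 x cs q d h L1 L2 :
  brepr (trun tm_of_bm x cs t0) q d h (L1 ++ L2) (size L1) ->
  brepr (trun tm_of_bm x cs (t0 + size L2)) (pass q L2).1 d h
    (L1 ++ (pass q L2).2) (size L1 + size L2).
Proof.
elim: L2 t0 q L1 => [|g L2 IH] t0 q L1 /=; first by rewrite !addn0.
move=> /(brepr_move (cs t0)) H.
have := IH t0.+1 (bmu q g).1 (rcons L1 (bmu q g).2).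
by rewrite !cat_rcons size_rcons !addSn !addnS; apply.
Qed.

Lemma brepr_turn c q d h L b :
  brepr c q d h L (size L) -> 
  let c' := tstep b c in
  if halt (bturn q).1 is Some v then cstate c' = inr v else
  let L' := L ++ seq_of_opt (bturn q).2 in
  brepr c' (bturn q).1 (~~ d) (h + sgz d * (Z.of_nat (size L') - 1)) (rev L') 0.
Proof.
case=> s1 h1 t1; rewrite /tstep /thalted s1 /=.
have -> : ctape c ord0 (chead c ord0) = None.
  by rewrite t1 h1 strip_at onth_default.
case E: (halt _) => [v|] //=; split=> //=.
  rewrite size_cat.
  by case: (bturn q).2 => [g|]; rewrite [size (seq_of_opt _)]/= h1; sgz_lia d.
move=> z; rewrite -strip_rev h1 t1.
case: (bturn q).2 => [g|]; rewrite /= ?cats0.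
  by have := strip_upd d h L [::] g z; rewrite cats0.
by case: Z.eqb_spec => // ->; rewrite strip_at onth_default.
Qed.

Definition bconf (x : seq bool) t := iter t (@bstep B) (q0, rev (map inp x)).

(* [bconf x t] is the configuration just after the [t]-th turn. *)
Fixpoint btime (x : seq bool) t :=
  if t is t'.+1 then btime x t' + (size (bconf x t').2).+1 else 0.

Lemma brepr_bstep t0 x cs c d h :
  brepr (trun tm_of_bm x cs t0) c.1 d h (rev c.2) 0 ->
  let c' := bstep c in
  let T := trun tm_of_bm x cs (t0 + (size c.2).+1) in
  if halt c'.1 is Some b then cstate T = inr b else
  exists d' h', brepr T c'.1 d' h' (rev c'.2) 0.
Proof.
case: c => q v H; have {H} := @brepr_pass t0 x cs q d h [::] (rev v) H.
rewrite size_rev add0n /=.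
rewrite -[in X in brepr _ _ _ _ _ X](size_rev v) -(size_pass q (rev v)).
move=> /brepr_turn -/(_ (cs (t0 + size v))).
rewrite addnS /=; case: (halt _) => // H.
by do 2 eexists; exact: H.
Qed.

Lemma trun_bconf x cs t :
  (forall i, 0 < i <= t -> halt (bconf x i).1 = None) ->
  exists d h, brepr (trun tm_of_bm x cs (btime x t)) (bconf x t).1 d h (rev (bconf x t).2) 0.
Proof.
elim: t => [|t IH] H.
  exists true, 0%Z; split=> //= z; rewrite revK /strip /=.
  have -> : (match (z - 0)%Z with 0 => 0 | Z.pos y' => Z.pos y' | Z.neg y' => Z.neg y' end = z)%Z.
    by rewrite Z.sub_0_r; case: z.
  case: Z.leb_spec => //= H1; rewrite (onth_if (inp false)) size_map.
  case: Z.ltb_spec => H2; last by rewrite ifF //; lia.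
  by rewrite ifT ?(nth_map false) //; lia.
have [|d [h]] := IH; first by move=> i Hi; apply: H; lia.
move=> /brepr_bstep; cbv zeta; rewrite -[bstep _]/(bconf x t.+1) H //; lia.
Qed.

Lemma trun_halted x cs t v :
  (forall i, 0 < i <= t -> halt (bconf x i).1 = None) ->
  halt (bconf x t.+1).1 = Some v ->
  cstate (trun tm_of_bm x cs (btime x t.+1)) = inr v :> tQ tm_of_bm.
Proof.
move=> /trun_bconf -/(_ cs) [d [h]].
by move=> /brepr_bstep + Hv; cbv zeta; rewrite -[bstep _]/(bconf x t.+1) Hv.
Qed.

End Compile.

Lemma trun_halt_stable (M : PTM) x cs t t' :
  t <= t' -> thalted (trun M x cs t) -> trun M x cs t' = trun M x cs t.
Proof.
move=> /subnKC <- H; elim: (t' - t) => [|k IH]; first by rewrite addn0.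
by rewrite addnS /= IH /tstep H.
Qed.

(** * Histories of a bouncing machine *)

Record GM := {
  gB :> BM;
  gbit : bG gB;
  gend : bG gB;
  gq0 : bQ gB;
  gacc : pred (bQ gB)
}.

Inductive letter (G : GM) :=
  | Bit of bool
  | End
  | Cell of bG G & option (bQ G).

Arguments Bit {G}.
Arguments End {G}.
Arguments Cell {G}.

Section LetterFinite.

Variable G : GM.

Definition letter_code (a : letter G) : option bool + bG G * option (bQ G) :=
  match a with
  | Bit b => inl (Some b) | End => inl None | Cell g o => inr (g, o)
  end.

Definition letter_decode (c : option bool + bG G * option (bQ G)) : letter G :=
  match c with
  | inl (Some b) => Bit b | inl None => End | inr (g, o) => Cell g o
  end.

Lemma letter_codeK : cancel letter_code letter_decode.
Proof. by case. Qed.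

HB.instance Definition _ := Finite.copy (letter G) (can_type letter_codeK).

End LetterFinite.

Section History.

Variable G : GM.
Notation Q := (bQ G).
Notation Gam := (bG G).

Notation letter := (letter G).

(** All input bits become the same symbol, so [G] sees only the length of the input, and row sizes
    and accepting times depend on nothing else. *)
Definition sym (a : letter) : Gam :=
  match a with
  | Bit _ => gbit G | End => gend G | Cell g _ => g
  end.

Definition ann (a : letter) : option Q :=
  match a with
  | Bit _ => None | End => Some (gq0 G) | Cell _ o => o
  end.

Definition gconf n t := iter t (@bstep G) (gq0 G, rcons (nseq n (gbit G)) (gend G)).

(** The state on the last cell marks the end of the row and is also the state in which the next
    sweep starts, so the boundary can begin its check from this one letter. *)
Fixpoint enc (q : Q) (v : seq Gam) : seq letter :=
  if v is g :: v' then
    Cell g (if v' is [::] then Some q else None) :: enc q v'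
  else [::].

Definition row (x : seq bool) t : seq letter :=
  if t is 0 then rcons [seq Bit b | b <- x] End
  else enc (gconf (size x) t).1 (gconf (size x) t).2.

Arguments row : simpl never.

(* Successive rows are written in opposite directions: the cell [k] steps before
   a row boundary and the one rewritten from it are mirror images about the
   boundary.  Streaming the word to the right and to the left at speed one
   therefore lets the boundary cell check a whole row in linear time. *)
Fixpoint hist (x : seq bool) t : seq letter :=
  (if t is t'.+1 then hist x t' else [::]) ++ row x t.

Definition padded (L : seq bool -> Prop) (u : seq letter) : Prop :=
  exists x t, [/\ u = hist x t, gacc (gconf (size x) t).1 & L x].

Lemma size_gconf n t : n < size (gconf n t).2.
Proof.
elim: t => [|t IH]; first by rewrite size_rcons size_nseq.
exact: leq_trans IH (size_bstep _).
Qed.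

Lemma size_gconf_mono n t t' :
  t <= t' -> size (gconf n t).2 <= size (gconf n t').2.
Proof.
move=> /subnKC <-; elim: (t' - t) => [|k IH]; first by rewrite addn0.
by rewrite addnS; apply: leq_trans IH (size_bstep _).
Qed.

Lemma size_enc q v : size (enc q v) = size v.
Proof. by elim: v => //= g v ->. Qed.

Lemma map_sym_enc q v : map sym (enc q v) = v.
Proof. by elim: v => //= g v ->. Qed.

Lemma map_ann_enc q v g :
  map ann (enc q (rcons v g)) = rcons (nseq (size v) None) (Some q).
Proof. by elim: v => //= h v ->; case: v. Qed.

Lemma map_sym_row x t : map sym (row x t) = (gconf (size x) t).2.
Proof.
case: t => [|t]; last exact: map_sym_enc.
by rewrite /row map_rcons; congr rcons; elim: x => //= b x ->.
Qed.

Lemma size_row x t : size (row x t) = size (gconf (size x) t).2.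
Proof. by rewrite -map_sym_row size_map. Qed.

Lemma map_ann_row x t :
  map ann (row x t) =
  rcons (nseq (size (row x t)).-1 None) (Some (gconf (size x) t).1).
Proof.
case: t => [|t].
  by rewrite /row size_rcons size_map map_rcons; congr rcons; elim: x => //= b x ->.
rewrite size_row /row; have := size_gconf (size x) t.+1.
case/lastP: (gconf (size x) t.+1).2 => // v g _.
by rewrite map_ann_enc size_rcons.
Qed.

Definition is_last (a : letter) : bool := isSome (ann a).

Lemma ann_row a0 x t i : i < size (row x t) ->
  ann (nth a0 (row x t) i) =
  if i.+1 == size (row x t) then Some (gconf (size x) t).1 else None.
Proof.
move=> lt; rewrite -(nth_map a0 None) // map_ann_row nth_rcons size_nseq.
case: (i.+1 =P _) => [e|ne]; last by rewrite ifT ?nth_nseq ?if_same //; lia.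
by rewrite -e ltnn eqxx.
Qed.

Lemma hist_pre x t : exists pre, hist x t = pre ++ row x t /\
  (pre = [::] \/ exists pre' a, pre = rcons pre' a /\ is_last a).
Proof.
case: t => [|t]; first by exists [::]; split; [|left].
exists (hist x t); split=> //; right.
have : exists pre, hist x t = pre ++ row x t by case: t => [|t]; eexists.
case=> pre ->.
have := size_row x t; have := size_gconf (size x) t; have := map_ann_row x t.
case/lastP: (row x t) => [|s a] H; first by move=> /[swap] <-.
move=> _ _; exists (pre ++ s), a; split; first by rewrite rcons_cat.
by move: H; rewrite map_rcons => /rcons_inj [_]; rewrite /is_last => ->.
Qed.

(* At a row boundary the checker is sweeping, or has finished the sweep and
   expects the cell appended by [bturn], or holds a verdict. *)
Definition chk_st : finType := ((Q + Gam * Q) + bool)%type.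

(** The sweep reads the preceding row backwards, so meeting the letter flagged as first in that row
    means that the sweep is over. *)
Definition cstep (s : chk_st) (cl : option (Gam * bool)) (cr : option letter)
  : chk_st :=
  match s with
  | inl (inl q) =>
    if cl is Some (g, first) then
      let p := bmu q g in
      let c := bturn p.1 in
      if first then
        if c.2 is Some h then
          if cr == Some (Cell p.2 None) then inl (inr (h, c.1)) else inr false
        else inr (cr == Some (Cell p.2 (Some c.1)))
      else if cr == Some (Cell p.2 None) then inl (inl p.1) else inr false
    else inr false
  | inl (inr (h, q)) => inr (cr == Some (Cell h (Some q)))
  | inr b => inr b
  end.

Fixpoint crun (s : chk_st) (cl : nat -> option (Gam * bool))
  (cr : nat -> option letter) k : chk_st :=
  if k is k'.+1 then cstep (crun s cl cr k') (cl k') (cr k') else s.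

Lemma crun_shift s cl cr k :
  crun s cl cr k.+1 =
  crun (cstep s (cl 0) (cr 0)) (fun i => cl i.+1) (fun i => cr i.+1) k.
Proof. by elim: k => //= k ->. Qed.

Lemma crun_done b cl cr k : crun (inr b) cl cr k = inr b.
Proof. by elim: k => //= k ->. Qed.

Definition next_row (q : Q) (s : seq Gam) : seq letter :=
  let p := pass q s in
  enc (bturn p.1).1 (p.2 ++ seq_of_opt (bturn p.1).2).

Lemma next_row_cons q g g2 s :
  next_row q (g :: g2 :: s) =
  Cell (bmu q g).2 None :: next_row (bmu q g).1 (g2 :: s).
Proof. by []. Qed.

(** A positive verdict needs every letter of the row to have been compared, so it is sound at
    whatever step it appears; completeness needs enough steps, after which the verdict is
    permanent. *)
Lemma crun_next q s cl cr :
  s <> [::] ->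
  (forall i, i < size s -> cl i = omap (fun g => (g, i.+1 == size s)) (onth s i)) ->
  let out := next_row q s in
  (forall k, crun (inl (inl q)) cl cr k = inr true ->
     forall i, i < size out -> cr i = onth out i) /\
  ((forall i, i < size out -> cr i = onth out i) ->
   forall k, size out <= k -> crun (inl (inl q)) cl cr k = inr true).
Proof.
case: s => // g s _; elim: s g q cl cr => [|g2 s IH] g q cl cr Hcl.
  have := Hcl 0 isT; rewrite /next_row /= => cl0.
  case E: (bturn _).2 => [h|] /=; split.
  - case=> [|k] //; rewrite crun_shift /= cl0 E.
    case: ifP => [/eqP e0|_]; last by rewrite crun_done.
    case: k => [|k] //; rewrite crun_shift /= crun_done => -[/eqP e1].
    by case=> [|[|//]].
  - move=> H [|[|k]] // _; rewrite !crun_shift /= cl0 E (H 0) //= eqxx /=.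
    by rewrite (H 1) //= eqxx crun_done.
  - case=> [|k] //; rewrite crun_shift /= cl0 E crun_done => -[/eqP e1].
    by case.
  - move=> H [|k] // _; rewrite !crun_shift /= cl0 E (H 0) //= eqxx /=.
    by rewrite crun_done.
have cl0 := Hcl 0 isT; cbv zeta; rewrite next_row_cons /=.
have [|H1 H2] := IH g2 (bmu q g).1 (fun i => cl i.+1) (fun i => cr i.+1).
  by move=> i Hi; rewrite Hcl.
split.
  case=> [|k] //; rewrite crun_shift /= cl0 /=.
  case: ifP => [/eqP e0|_]; last by rewrite crun_done.
  by move=> /H1 {}H1 [|i] // /H1.
move=> H [|k] // Hk; rewrite crun_shift /= cl0 /= (H 0) //= eqxx.
by apply: H2 => // i Hi; exact: (H i.+1).
Qed.

Variable u : seq letter.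

(** The default at position 0 only serves to flag it as the start of a row. *)
Definition first_at p := if p is p'.+1 then obind ann (onth u p') else Some (gq0 G).

Definition left_at p : option (Gam * bool) :=
  omap (fun a => (sym a, isSome (first_at p))) (onth u p).

Definition left_stream p k := if k < p then left_at (p - k.+1) else None.

Definition right_stream p k := onth u (p + k).

(** These windows force the shape: bits, [End], cells. The condition at the right end is where
    acceptance by [G] is enforced. *)
Definition local_ok (l : option letter) (a : letter) (r : option letter) : bool :=
  match l, a with
  | None, (Bit _ | End) => true
  | Some (Bit _), (Bit _ | End) => true
  | Some End, Cell _ _ => true
  | Some (Cell _ _), Cell _ _ => true
  | _, _ => false
  end && (if r is None then if ann a is Some q then gacc q else false else true).

Definition all_local : Prop := forall p a, onth u p = Some a ->
  local_ok (if p is p'.+1 then onth u p' else None) a (onth u p.+1).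

Definition chk_at p k : chk_st :=
  if p is p'.+1 then
    if obind ann (onth u p') is Some q then
      crun (inl (inl q)) (left_stream p) (right_stream p) k
    else inr true
  else inr true.

Lemma first_at_row pre x t rest j : u = pre ++ row x t ++ rest ->
  (pre = [::] \/ exists pre' a, pre = rcons pre' a /\ is_last a) ->
  j < size (row x t) -> isSome (first_at (size pre + j)) = (j == 0).
Proof.
move=> uE Hpre; case: j => [|j] Hj.
  rewrite addn0; case: Hpre => [->//|[pre' [a [preE la]]]].
  rewrite preE size_rcons /= uE preE onth_cat size_rcons ltnSn.
  by rewrite -cats1 onth_cat ltnn subnn.
rewrite addnS /= uE onth_cat ifF; last lia.
rewrite addKn onth_cat ifT; last lia.
rewrite (onth_if End) ifT; last lia.
by rewrite /= ann_row ?ifF //; lia.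
Qed.

Lemma left_stream_row x t rest : u = hist x t ++ rest ->
  let v := (gconf (size x) t).2 in
  forall i, i < size v ->
  left_stream (size (hist x t)) i =
  omap (fun g => (g, i.+1 == size v)) (onth (rev v) i).
Proof.
have [pre [-> Hpre]] := hist_pre x t; rewrite -catA => uE v i.
rewrite -[v]map_sym_row -map_rev size_map => Hi.
rewrite /left_stream /left_at size_cat ifT; last lia.
have -> : size pre + size (row x t) - i.+1 = size pre + (size (row x t) - i.+1) by lia.
rewrite (first_at_row uE Hpre); last lia.
rewrite onth_map uE onth_cat ifF; last lia.
rewrite addKn onth_cat ifT; last lia.
rewrite !(onth_if End) size_rev Hi ifT; last lia.
by rewrite nth_rev //=; congr (Some (_, _)); lia.
Qed.

Lemma last_ann_hist x t rest : u = hist x t ++ rest ->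
  exists p, size (hist x t) = p.+1 /\
    obind ann (onth u p) = Some (gconf (size x) t).1.
Proof.
have [pre [-> _]] := hist_pre x t => ->.
have Hs : 0 < size (row x t) by rewrite size_row; have := size_gconf (size x) t; lia.
exists (size pre + (size (row x t)).-1); rewrite size_cat; split; first lia.
rewrite onth_cat size_cat ifT; last lia.
rewrite onth_cat ifF; last lia.
rewrite addKn (onth_if End) ifT; last lia.
by rewrite /= ann_row ?ifT //; lia.
Qed.

Lemma next_row_row x t :
  next_row (gconf (size x) t).1 (rev (gconf (size x) t).2) = row x t.+1.
Proof. by []. Qed.

Lemma prefix_ext (T : Type) (h r rest : seq T) :
  (forall i, i < size r -> onth (h ++ rest) (size h + i) = onth r i) ->
  exists rest', rest = r ++ rest'.
Proof.
move=> H; have {}H i : i < size r -> onth rest i = onth r i.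
  by move=> /H; rewrite onth_cat ifF ?addKn //; lia.
elim: r rest H => [|x r IH] rest H; first by exists rest.
have := H 0 isT; case: rest H => // y rest H /= [->].
by have [|rest' ->] := IH rest; [move=> i; exact: (H i.+1) | exists rest'].
Qed.

Lemma local_row0 : u <> [::] -> all_local ->
  exists x rest, u = hist x 0 ++ rest.
Proof.
move=> u0 Hl.
have : local_ok None (nth End u 0) (onth u 1).
  by have := Hl 0; case: u u0 => // a s _ /(_ a erefl).
have {}Hl p a b : onth u p = Some a -> onth u p.+1 = Some b ->
    local_ok (Some a) b (onth u p.+2).
  by move=> Ha Hb; have := Hl p.+1 b Hb; rewrite /= Ha.
have Hend : forall a, local_ok None a None -> exists q, ann a = Some q.
  by move=> [b||g o] //= _; exists (gq0 G).
case: u u0 Hl => // a s _; rewrite [nth _ _ _]/=.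
elim: s a => [|b s IH] a Hl Ha.
  have [q] := Hend a Ha; case: a Hl Ha => [b||g o] //= _ _ _.
  by exists [::], [::].
case: a Hl Ha => [c||g o] //= Hl _; last by exists [::], (b :: s).
have H1 := Hl 0 _ _ erefl erefl.
have [||x [rest E]] := IH b.
- by move=> p; exact: (Hl p.+1).
- by case: b H1 Hl {IH} => //.
by exists (c :: x), rest; rewrite E.
Qed.

(** [G] is deterministic, so a boundary that passes leaves no freedom for the row after it. The word
    is consumed row by row until nothing remains, and then its last letter certifies acceptance. *)
Lemma chk_sound :
  u <> [::] -> all_local ->
  (forall p, p < size u -> exists k, chk_at p k = inr true) ->
  exists x t, u = hist x t /\ gacc (gconf (size x) t).1.
Proof.
move=> u0 Hl Hc; have [x [rest E]] := local_row0 u0 Hl.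
suff H n : forall t (rest : seq letter), (size rest < n) -> (u = hist x t ++ rest) ->
   exists t, u = hist x t /\ gacc (gconf (size x) t).1.
  by have [t Ht] := H _ 0 rest (ltnSn _) E; exists x, t.
elim: n => // n IH t {E}rest Hr E.
have [p [pE annE]] := last_ann_hist E.
case: rest Hr E => [|a rest] Hr E.
  exists t; rewrite E cats0; split=> //.
  have EN : onth u p.+1 = None by rewrite -pE E cats0 onth_default.
  case Ep: (onth u p) annE => [b|] // annE.
  have := Hl p b Ep; rewrite EN /local_ok.
  by rewrite [obind _ _]/= in annE; rewrite annE => /andP[].
have [k] : exists k, chk_at p.+1 k = inr true.
  by apply: Hc; rewrite E size_cat -pE /=; lia.
rewrite /chk_at annE => Hk.
have Hs := size_gconf (size x) t.
have [||H _] := @crun_next (gconf (size x) t).1 (rev (gconf (size x) t).2)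
  (left_stream p.+1) (right_stream p.+1).
- by move/(congr1 size); rewrite size_rev => e; move: Hs; rewrite e.
- by rewrite -pE size_rev; apply: left_stream_row E.
have [|rest' E'] := @prefix_ext _ (hist x t) (row x t.+1) (a :: rest).
  by move=> i Hi; rewrite -E pE; apply: (H k).
apply: (IH t.+1 rest'); last by rewrite E E' catA.
have : size (a :: rest) = size (row x t.+1) + size rest' by rewrite E' size_cat.
by rewrite size_row; have := size_gconf (size x) t.+1; lia.
Qed.

Lemma hist_boundary x t p : 0 < p < size (hist x t) ->
  obind ann (onth (hist x t) p.-1) != None ->
  exists2 s, s < t & p = size (hist x s).
Proof.
elim: t p => [|t IH] p.
  rewrite -[hist x 0]/(row x 0) => /andP[p0 lt]; rewrite (onth_if End) ifT; last lia.
  by rewrite [obind _ _]/= ann_row ?ifF //; lia.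
rewrite [hist x t.+1]/= size_cat; case: (ltngtP p (size (hist x t))) => Hp.
- move=> Hp2; rewrite onth_cat ifT; last lia.
  by case/IH => [|s Hs ->]; [lia | exists s => //; lia].
- move=> Hp2; rewrite onth_cat ifF; last lia.
  rewrite (onth_if End) ifT; last lia.
  by rewrite [obind _ _]/= ann_row ?ifF //; lia.
- by move=> _ _; exists t.
Qed.

Lemma hist_prefix x t t' : t <= t' -> exists rest, hist x t' = hist x t ++ rest.
Proof.
move=> /subnKC <-; elim: (t' - t) => [|k [r E]].
  by exists [::]; rewrite addn0 cats0.
by rewrite addnS /= E; eexists; rewrite -catA.
Qed.

Lemma chk_complete x t p k :
  u = hist x t -> p < size u -> size (gconf (size x) t).2 <= k ->
  chk_at p k = inr true.
Proof.
case: p => // p uE Hp Hk; rewrite /chk_at.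
case Ea: (obind _ _) => [q|] //.
have [||s st pE] := @hist_boundary x t p.+1; rewrite -?uE //; first by rewrite Ea.
have [rest histE] := hist_prefix x st; move: (histE); rewrite /= -catA => histE'.
have [p' []] := @last_ann_hist x s (row x s.+1 ++ rest) (etrans uE histE').
rewrite -pE => -[<-]; rewrite Ea => -[->].
have [||_] := @crun_next (gconf (size x) s).1 (rev (gconf (size x) s).2)
  (left_stream p.+1) (right_stream p.+1).
- by move/(congr1 size); rewrite size_rev => e; have := size_gconf (size x) s; rewrite e.
- by rewrite pE size_rev; apply: left_stream_row (etrans uE histE').
rewrite next_row_row; apply.
  move=> i Hi; rewrite /right_stream uE histE' pE onth_cat ifF; last lia.
  by rewrite addKn onth_cat Hi.
by apply: leq_trans Hk; rewrite size_row; apply: size_gconf_mono.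
Qed.

Definition is_cell (a : letter) : bool := if a is Cell _ _ then true else false.

Lemma hist_shape x t : exists s,
  hist x t = [seq Bit b | b <- x] ++ End :: s /\ all is_cell s.
Proof.
elim: t => [|t [s [E As]]]; first by exists [::]; rewrite /= /row cats1.
rewrite /= E -catA; eexists; split; first by [].
rewrite all_cat As /= /row.
by elim: (gconf _ _).2 => //.
Qed.

(** The bits in front of [End] spell the input. Were one word to pad two inputs, its membership
    would not decide that of either. *)
Lemma hist_decode x t x' t' : hist x t = hist x' t' -> x = x'.
Proof.
have [s [-> _]] := hist_shape x t; have [s' [-> _]] := hist_shape x' t'.
elim: x x' => [|b x IH] [|b' x'] //= [-> E].
by rewrite (IH x' E).
Qed.

Lemma onth_hist_bit x t p : p <= size x ->
  onth (hist x t) p = Some (if onth x p is Some b then Bit b else End).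
Proof.
have [s [-> _]] := hist_shape x t; rewrite onth_cat size_map leq_eqVlt orbC.
case: ltnP => [lt _|ge /= /eqP ->].
  by rewrite onth_map (onth_if false) lt.
by rewrite subnn (@onth_default _ _ x).
Qed.

Lemma onth_hist_cell x t p : size x < p < size (hist x t) ->
  exists g o, onth (hist x t) p = Some (Cell g o).
Proof.
have [s [-> As]] := hist_shape x t; rewrite onth_cat size_map size_cat size_map.
move=> /= /andP[lt lt2]; rewrite ifF; last lia.
have E : p - size x = (p - size x).-1.+1 by lia.
have lt3 : (p - size x).-1 < size s by lia.
rewrite E /= (onth_if End) lt3.
by have /all_nthP-/(_ End _ lt3) := As; case: (nth _ _ _) => // g o _; exists g, o.
Qed.

Lemma local_complete x t : u = hist x t -> gacc (gconf (size x) t).1 -> all_local.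
Proof.
move=> uE Ga p a Hp.
have Hsz : p < size u by rewrite -onthTE Hp.
have [s [hE _]] := hist_shape x t.
have nsz : size x < size u by rewrite uE hE size_cat size_map /=; lia.
rewrite /local_ok; apply/andP; split.
  case: p Hp Hsz => [|p] Hp Hsz.
    by move: Hp; rewrite uE onth_hist_bit //; case: onth => [b|] [<-].
  case: (ltngtP p (size x)) => Hpx.
  - move: Hp; rewrite uE !onth_hist_bit //; last lia.
    by rewrite [onth x p](onth_if false) Hpx; case: (onth x p.+1) => [b|] [<-].
  - have [|g [o E]] := @onth_hist_cell x t p; first by rewrite -uE; lia.
    have [|g' [o' E']] := @onth_hist_cell x t p.+1; first by rewrite -uE; lia.
    by move: Hp; rewrite uE E E' => -[<-].
  - have [|g' [o' E']] := @onth_hist_cell x t p.+1; first by rewrite -uE; lia.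
    move: Hp; rewrite uE E' Hpx => -[<-].
    by rewrite onth_hist_bit // onth_default.
case Ep: (onth u p.+1) => [//|].
have [|p' [pE Ea]] := @last_ann_hist x t [::]; first by rewrite cats0.
have pp : p = p'.
  have : ~~ (p.+1 < size u) by rewrite -onthTE Ep.
  by rewrite uE pE in Hsz *; lia.
by move: Ea; rewrite -pp Hp /= => ->.
Qed.

End History.

(** * Simulating a multitape machine on a line of cells *)

Record SM := {
  sS : finType;
  sI : finType;
  sA : finType;
  sdelta : bool -> bool -> sS -> (sI -> sA) ->
           sS * (sI -> sA) * (sI -> option bool)
}.

Definition shift_Z (m : option bool) : Z :=
  match m with None => 0%Z | Some true => 1%Z | Some false => (-1)%Z end.

Section Sim.

Variable M : SM.
Notation S := (sS M).
Notation I := (sI M).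
Notation A := (sA M).
Notation cont := {ffun I -> A * A}.

(** Tapes are stored relative to their heads, so a head move shifts the whole tape and cell 0 stays
    under all heads. *)
Definition rconf : Type := S * (I -> Z -> A).

Definition rout (b1 b2 : bool) (c : rconf) :=
  @sdelta M b1 b2 c.1 (fun i => c.2 i 0%Z).

Definition rwritten b1 b2 (c : rconf) i z :=
  if Z.eqb z 0 then (rout b1 b2 c).1.2 i else c.2 i z.

Definition rstep b1 b2 (c : rconf) : rconf :=
  ((rout b1 b2 c).1.1,
   fun i z => rwritten b1 b2 c i (z + shift_Z ((rout b1 b2 c).2 i))).

Fixpoint rrun (c : rconf) (b : nat -> bool) s : rconf :=
  if s is s'.+1 then rstep (b s'.*2) (b s'.*2.+1) (rrun c b s') else c.

(* Cell [j] of the folded tapes stores the symbols at offsets [j] and [-j] from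
   the heads; [prv] is its content before the last machine step (after the
   write, for cell 0), and [cmd] the head moves of that step. *)
Record simcell := SimCell {
  cur : cont; prv : cont; cmd : {ffun I -> option bool}; fresh : bool;
  ctl : option (S * option bool)
}.

Definition simcell_code (c : simcell) := (cur c, prv c, cmd c, fresh c, ctl c).
Definition simcell_decode (t : cont * cont * {ffun I -> option bool} * bool *
    option (S * option bool)) :=
  let: (c, p, m, f, k) := t in SimCell c p m f k.
Lemma simcell_codeK : cancel simcell_code simcell_decode.
Proof. by case. Qed.
HB.instance Definition _ := Finite.copy simcell (can_type simcell_codeK).

(* A machine step takes two cell steps, so that a move command travelling away
   from cell 0 at speed one finds the right neighbour not yet updated; the left
   neighbour, which has just been updated, supplies [prv]. *)
Definition simstep (b : bool) (l : option simcell) (q : simcell)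
  (r : option simcell) : simcell :=
  let rc := if r is Some r' then cur r' else cur q in
  match ctl q with
  | Some (s, None) => SimCell (cur q) (prv q) (cmd q) false (Some (s, Some b))
  | Some (s, Some b1) =>
    let o := @sdelta M b1 b s (fun i => (cur q i).1) in
    SimCell [ffun i => match o.2 i with
                       | None => (o.1.2 i, o.1.2 i)
                       | Some true => ((rc i).1, (rc i).1)
                       | Some false => ((rc i).2, (rc i).2)
                       end]
            [ffun i => (o.1.2 i, o.1.2 i)] [ffun i => o.2 i] true
            (Some (o.1.1, None))
  | None =>
    if l is Some lc then
      if fresh lc then
        SimCell [ffun i => match cmd lc i with
                           | None => cur q i
                           | Some true => ((rc i).1, (prv lc i).2)
                           | Some false => ((prv lc i).1, (rc i).2)
                           end]
                (cur q) (cmd lc) true None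
      else SimCell (cur q) (prv q) (cmd q) false None
    else q
  end.

Section Run.

Variables (N : nat) (b : nat -> nat -> bool) (init : nat -> simcell) (c0 : rconf).

Fixpoint simT (t : nat) (j : nat) : simcell :=
  if t is t'.+1 then
    simstep (b t' j) (if j is j'.+1 then Some (simT t' j') else None)
      (simT t' j) (if j.+1 < N then Some (simT t' j.+1) else None)
  else init j.

Hypothesis initE : forall j, j < N ->
  [/\ forall i, cur (init j) i = (c0.2 i (Z.of_nat j), c0.2 i (- Z.of_nat j)%Z),
      fresh (init j) = false
    & ctl (init j) = if j is 0 then Some (c0.1, None) else None].

Let b0 t := b t 0.
Let R s := rrun c0 b0 s.
Let out s := rout (b0 s.*2) (b0 s.*2.+1) (R s).
Let W s := rwritten (b0 s.*2) (b0 s.*2.+1) (R s).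

Definition fold_of (f : I -> Z -> A) (j : nat) (i : I) : A * A :=
  (f i (Z.of_nat j), f i (- Z.of_nat j)%Z).

Lemma ctl_cell t j : 0 < j < N -> ctl (simT t j) = None.
Proof.
move=> /andP[j0 jN]; elim: t => [|t IH] /=.
  by case: (initE jN) => _ _ ->; case: (j) j0.
by rewrite /simstep IH; case: (j) j0 => // j' _; case: ifP.
Qed.

Lemma ctl_head t : 0 < N ->
  exists s, ctl (simT t 0) = Some (s, if odd t then Some (b0 t.-1) else None).
Proof.
move=> N0; elim: t => [|t [s IH]] /=.
  by case: (initE N0) => _ _ ->; exists c0.1.
by rewrite /simstep IH; case: (odd t) => /=; eexists.
Qed.

Lemma fresh_sim t j : j < N ->
  fresh (simT t j) = [&& j.+1 < t & ~~ odd (t - j)].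
Proof.
elim: t j => [|t IH] j jN; first by case: (initE jN).
rewrite /=; case: j jN => [|j] jN.
  have [s E] := ctl_head t jN; rewrite /simstep E subn0 /=.
  by case: (t) => // t'; rewrite /= negbK; case: (odd t').
rewrite /simstep ctl_cell // IH; last lia.
rewrite subSS ltnS; case: ifP => //=.
Qed.

(* The missing right neighbour of cell [N.-1] corrupts the folded tapes, but the
   error moves by at most one cell per machine step. *)
Lemma sim_invariant t j : j < N ->
  let s := (t - j)./2 in
  [/\ j = 0 -> s < N ->
        ctl (simT t j) = Some ((R s).1, if odd t then Some (b0 t.-1) else None),
      s + j < N -> forall i, cur (simT t j) i = fold_of (R s).2 j i
    & j.+1 < t -> s + j <= N ->
        (forall i, prv (simT t j) i = fold_of (W s.-1) j i) /\
        (forall i, cmd (simT t j) i = (out s.-1).2 i)].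
Proof.
elim: t j => [|t IH] j jN s.
  rewrite /s sub0n; case: (initE jN) => H1 _ H3; split=> //.
  by rewrite H3 => -> .
case: j jN @s => [|j] jN s.
  have [I1 I2 I3] := IH 0 jN.
  rewrite {}/s subn0 /=; rewrite subn0 in I1 I2 I3.
  have hE : uphalf t = odd t + t./2 by rewrite uphalf_half.
  rewrite /simstep hE.
  have [s0 Es0] := ctl_head t jN.
  case ot: (odd t) Es0 I1 => Es0 I1; last first.
    rewrite Es0 /= !add0n; rewrite !addn0 in I2 I3 *; split=> //.
    + by move=> _ Hs; move: (I1 erefl Hs); rewrite Es0 => -[->].
    + by move=> t1 Hs; apply: I3 => //; case: (t) ot t1 => [|[|]].
  rewrite Es0 /= !add1n; rewrite !addn0 in I2 I3 *.
  have tE : (t./2).*2 = t.-1 by lia.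
  have tE1 : ((t./2).*2).+1 = t by lia.
  have ctlE : t./2 < N -> s0 = (R t./2).1.
    by move=> Hs; move: (I1 erefl Hs); rewrite Es0 => -[->].
  have outE : t./2 < N ->
      @sdelta M (b0 t.-1) (b t 0) s0 (fun i => (cur (simT t 0) i).1) = out t./2.
    move=> Hs; rewrite /out /rout tE1 tE -(ctlE Hs) /b0; congr sdelta.
    by apply: functional_extensionality => i; rewrite I2 //.
  split.
  + by move=> _ Hs; rewrite outE; last lia.
  + move=> Hs i; rewrite outE; last lia.
    rewrite ffunE ifT; last lia.
    have [_ J2 _] := IH 1 (leq_ltn_trans (ltn0Sn _) Hs).
    have hE1 : (t - 1)./2 = t./2 by lia.
    rewrite /fold_of /R /= -/(R _) /rwritten -/(out _).
    case: ((out t./2).2 i) => [[]|] //=; rewrite J2 ?hE1 //; lia.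
  + move=> _ Hs; rewrite outE; last lia.
    split=> i; rewrite ffunE //.
have [I1 I2 I3] := IH j.+1 jN.
have [_ L2 L3] := IH j (ltnW jN).
rewrite [simT _ _]/= /simstep ctl_cell // fresh_sim; last lia.
(* When the left neighbour is fresh it has completed [s] machine steps, while this cell and its
   right neighbour are still at [s.-1]: the right one supplies [cur], the left one its saved
   [prv]. *)
case: ifP => [/andP[jt ev]|nfr].
  have sE : (t - j.+1)./2 = s.-1 by rewrite /s; lia.
  have sE' : (t - j)./2 = s by rewrite /s; lia.
  have s0 : 0 < s by rewrite /s; lia.
  rewrite sE in I2; rewrite sE' in L3; split=> //.
  - move=> Hs i; rewrite ffunE ifT; last lia.
    have [|_ R2 _] := IH j.+2; first lia.
    have {}R2 := R2 _ i; rewrite (_ : (t - j.+2)./2 = s.-1) in R2; last by rewrite /s; lia.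
    have [|P1 P2] := L3 jt; first lia.
    rewrite P2 P1 I2; last lia.
    rewrite R2; last lia.
    have RS z : (R s).2 i z = W s.-1 i (z + shift_Z ((out s.-1).2 i)).
      by rewrite -{1}(prednK s0).
    rewrite /fold_of !RS /W /rwritten -/(out _) {R2 I2 P1 P2 RS}.
    case: ((out s.-1).2 i) => [[]|]; rewrite [shift_Z _]/=; congr pair;
    (repeat case: Z.eqb_spec); move=> *; try lia; rewrite // ?[fst _]/= ?[snd _]/=;
    congr ((R s.-1).2 i _); lia.
  - move=> jt' Hs; have [|P1 P2] := L3 jt; first lia.
    split=> i /=; rewrite ?P2 // I2 /fold_of /rwritten; last lia.
    by repeat case: Z.eqb_spec; try lia.
have sE : (t - j.+1)./2 = s.
  rewrite /s subSS; case: (ltnP j.+1 t) nfr => /= [lt /negbFE ev|]; lia.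
rewrite sE in I2 I3; split=> // jt' Hs /=.
apply: I3 => //; rewrite ltnS in jt'; move: nfr; rewrite jt' /= => /negbFE.
by move=> ev; lia.
Qed.


Lemma sim_state_exact t :
  0 < N -> t./2 < N -> omap fst (ctl (simT t 0)) = Some (R t./2).1.
Proof.
move=> N0 Ht; have [H _ _] := sim_invariant t N0.
by rewrite subn0 in H; rewrite H.
Qed.

(** A halted state is kept whatever is read, so errors that reach cell 0 after halting do no
    harm. *)
Lemma sim_state_halt (hlt : pred S) s t :
  (forall b1 b2 q r, hlt q -> (@sdelta M b1 b2 q r).1.1 = q) ->
  s < N -> hlt (R s).1 -> s.*2 <= t ->
  omap fst (ctl (simT t 0)) = Some (R s).1.
Proof.
move=> Hd Hs Hh /subnKC <-; elim: (t - s.*2) => [|k IH].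
  by rewrite addn0 sim_state_exact ?doubleK //; lia.
rewrite addnS /= /simstep.
have [|q E] := ctl_head (s.*2 + k); first lia.
move: IH; rewrite E /= => -[qE]; case: ifP => _ /=; last by rewrite qE.
by rewrite qE Hd.
Qed.

End Run.
End Sim.

(** * Two runs of a probabilistic machine side by side *)

Section PairMachine.

Variable M : PTM.
Notation tape := 'I_(tk M).+1.

Definition move_opt (m : move) : option bool :=
  match m with MoveL => Some false | MoveS => None | MoveR => Some true end.

Definition halted_state (q : tQ M) : bool := (q == tqacc M) || (q == tqrej M).

Definition single_delta (b : bool) (q : tQ M) (r : tape -> tG M) :=
  if halted_state q then (q, r, fun=> None) else
  ((@tdelta M b q r).1.1, (@tdelta M b q r).1.2, fun i => move_opt ((@tdelta M b q r).2 i)).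

Definition pair_delta (b1 b2 : bool) (q : tQ M * tQ M)
    (r : bool * tape -> tG M) :
    (tQ M * tQ M) * (bool * tape -> tG M) * (bool * tape -> option bool) :=
  let o k := single_delta (if k then b1 else b2) (if k then q.1 else q.2)
               (fun i => r (k, i)) in
  (((o true).1.1, (o false).1.1), fun i => (o i.1).1.2 i.2, fun i => (o i.1).2 i.2).

(* Two independent copies raise the acceptance probability from 1/2 to 3/4. *)
Definition pair_sm : SM :=
  @Build_SM (tQ M * tQ M)%type (bool * tape)%type (tG M) pair_delta.

Variable x : seq bool.

Definition pair_sym (i : bool * tape) (z : Z) : tG M :=
  if [&& i.2 == ord0, (0 <=? z)%Z & (z <? Z.of_nat (size x))%Z] then
    tsym M (nth false x (Z.to_nat z)) else tblank M.

Definition pair_conf0 : rconf pair_sm := ((tq0 M, tq0 M), pair_sym).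

Definition single_rel (c : tconf M) (i : tape) (z : Z) : tG M :=
  ctape c i (chead c i + z)%Z.

Lemma single_step b (c : tconf M) :
  let o := single_delta b (cstate c) (fun i => single_rel c i 0) in
  cstate (tstep b c) = o.1.1 /\
  forall i z, single_rel (tstep b c) i z =
    let y := (z + shift_Z (o.2 i))%Z in
    if Z.eqb y 0 then o.1.2 i else single_rel c i y.
Proof.
rewrite /single_delta /tstep /thalted -/(halted_state _).
case: (halted_state _) => /=.
  split=> // i z; rewrite Z.add_0_r; case: Z.eqb_spec => // ->.
  by [].
have -> : (fun i => single_rel c i 0) = (fun i => ctape c i (chead c i)).
  by apply: functional_extensionality => i; rewrite /single_rel Z.add_0_r.
case: (tdelta _ _ _) => [[q w] m] /=; split=> // i z.
rewrite /single_rel /=.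
have -> : (chead c i + move_Z (m i) + z = chead c i + (z + shift_Z (move_opt (m i))))%Z.
  by case: (m i) => /=; lia.
by case: Z.eqb_spec; case: Z.eqb_spec => //; lia.
Qed.

(** Even coins drive one copy and odd coins the other, which makes the two runs independent. *)
Lemma rrun_pair (b : nat -> bool) s :
  let c1 := trun M x (fun t => b t.*2) s in
  let c2 := trun M x (fun t => b t.*2.+1) s in
  let c := rrun pair_conf0 b s in
  c.1 = (cstate c1, cstate c2) /\
  forall i z, c.2 i z = single_rel (if i.1 then c1 else c2) i.2 z.
Proof.
elim: s => [|s [IH1 IH2]].
  split=> // -[k i] z; rewrite /= /pair_sym /single_rel /=.
  by case: k; rewrite /= andbA.
cbv zeta; rewrite [trun _ _ _ _.+1]/= [trun _ _ (fun t => b t.*2.+1) _.+1]/=.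
set c1 := trun M x (fun t => b t.*2) s in IH1 IH2 *.
set c2 := trun M x (fun t => b t.*2.+1) s in IH1 IH2 *.
have [S1 T1] := single_step (b s.*2) c1.
have [S2 T2] := single_step (b s.*2.+1) c2.
rewrite /=; set c := rrun pair_conf0 b s in IH1 IH2 *.
have E k : (fun i => c.2 (k, i) 0%Z) = (fun i => single_rel (if k then c1 else c2) i 0).
  by apply: functional_extensionality => i; rewrite IH2.
split; first by rewrite /rstep /rout /= /pair_delta /= IH1 !E S1 S2.
move=> [k i] z; rewrite /rstep /rwritten /rout /= /pair_delta IH1 /=.
by case: k; rewrite /= !E ?T1 ?T2 /= IH2.
Qed.

End PairMachine.

(** * The probabilistic automaton for the padded language *)

Local Arguments onth : simpl never.

Lemma size_ca_step (Q : Type) d (s : seq Q) : size (ca_step d s) = size s.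
Proof. by rewrite size_map size_zip size_iota minnn. Qed.

Lemma onth_ca_step (Q : Type) d (s : seq Q) i :
  onth (ca_step d s) i =
  omap (fun q => d i (if i is k.+1 then onth s k else None) q (onth s i.+1))
    (onth s i).
Proof.
rewrite onth_map; case E: s => [|q0 s']; first by rewrite /= !onth0n.
rewrite -E !(onth_if (0, q0)) [onth s i](onth_if q0) size_zip size_iota minnn.
by case: ifP => // lt; rewrite nth_zip ?size_iota // nth_iota.
Qed.

Record pcell (G : GM) (M : SM) := PCell {
  pright : option (bG G * bool);
  pleft : option (letter G);
  pchk : chk_st G;
  psim : simcell M
}.

Section PcellFinite.

Variables (G : GM) (M : SM).

Definition pcell_code (c : pcell G M) := (pright c, pleft c, pchk c, psim c).
Definition pcell_decode
    (t : option (bG G * bool) * option (letter G) * chk_st G * simcell M) :=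
  let: (r, l, k, s) := t in PCell r l k s.
Lemma pcell_codeK : cancel pcell_code pcell_decode.
Proof. by case. Qed.

HB.instance Definition _ := Finite.copy (pcell G M) (can_type pcell_codeK).

End PcellFinite.

Section Verifier.

Variables (G : GM) (M : PTM).
Notation SMM := (pair_sm M).

Definition pstate : finType := (letter G + pcell G SMM)%type.

Definition state_letter (s : pstate) : letter G := if s is inl a then a else End.

Definition state_cell (s : pstate) : option (pcell G SMM) :=
  if s is inr c then Some c else None.

(** The two halves of a folded tape share offset 0, so the head cell stores its symbol twice; all
    other cells have a blank at their negative offset. *)
Definition init_sim (is_head : bool) (a : letter G) : simcell SMM :=
  let v (i : sI SMM) : sA SMM :=
    if a is Bit b then (if i.2 == ord0 then tsym M b else tblank M)
    else tblank M in
  let f := [ffun i : sI SMM => (v i, if is_head then v i else tblank M)] in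
  SimCell f f [ffun=> None] false
    (if is_head then Some ((tq0 M, tq0 M), None) else None).

(** The local conditions are tested in the first step, while the neighbours still hold plain
    letters. That step ignores its coins, so the simulation uses those from step 1 on. *)
Definition pinit (l : option (letter G)) (a : letter G) (r : option (letter G))
  : pcell G SMM :=
  PCell (Some (sym a, if l is Some a' then is_last a' else true)) (Some a)
    (if local_ok l a r then
       if obind (@ann G) l is Some q then inl (inl q) else inr true
     else inr false)
    (init_sim (l == None) a).

Definition pstep b (l : option pstate) (q : pstate) (r : option pstate) : pstate :=
  match q with
  | inl a => inr (pinit (omap state_letter l) a (omap state_letter r))
  | inr c =>
    let lc := obind state_cell l in
    let rc := obind state_cell r in
    inr (PCell (obind (@pright G SMM) lc) (obind (@pleft G SMM) rc)
      (cstep (pchk c) (obind (@pright G SMM) lc) (pleft c))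
      (simstep b (omap (@psim G SMM) lc) (psim c) (omap (@psim G SMM) rc)))
  end.

Definition accepting_pair (q : tQ M * tQ M) : bool :=
  (q.1 == tqacc M) || (q.2 == tqacc M).

Definition paccept (s : pstate) : bool :=
  if s is inr c then
    (pchk c == inr true) &&
    (if ctl (psim c) is Some (q, _) then accepting_pair q else true)
  else false.

Lemma pinp_proof : injective (inl : letter G -> pstate).
Proof. by move=> a a' []. Qed.

Definition verifier : PACA (letter G) := Build_PACA pinp_proof pstep paccept.

Section Run.

Variables (u : seq (letter G)) (cs : nat -> nat -> bool).
Notation N := (size u).

Definition local_at i :=
  if onth u i is Some a then
    local_ok (if i is i'.+1 then onth u i' else None) a (onth u i.+1)
  else true.

Definition sim_at := simT N (fun t j => cs t.+1 j) (fun j => init_sim (j == 0) (nth End u j)).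

(** The state after [t.+1] steps: one step loads the cells, the others move both streams by [t]
    positions. *)
Definition cell_at t i : pcell G SMM :=
  PCell (if t <= i then left_at u (i - t) else None) (onth u (i + t))
    (if local_at i then chk_at u i t else inr false) (sim_at t i).

Lemma size_pconf t : size (pconf verifier u cs t) = N.
Proof.
by elim: t => [|t IH]; [exact: size_map | rewrite [pconf _ _ _ _]/= size_ca_step].
Qed.

Lemma pconf_cell t i : i < N ->
  onth (pconf verifier u cs t.+1) i = Some (inr (cell_at t i)).
Proof.
elim: t i => [|t IH] i Hi.
  have ui : onth u i = Some (nth End u i) by rewrite (onth_if End) Hi.
  rewrite onth_ca_step /= !onth_map ui /=; congr (Some (inr _)).
  rewrite /pinit /cell_at subn0 leq0n addn0 ui /left_at ui /= /local_at ui.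
  have -> : omap state_letter (omap inl (onth u i.+1)) = onth u i.+1 by case: onth.
  have -> : omap state_letter (if i is k.+1 then onth (map inl u) k else None)
     = if i is k.+1 then onth u k else None.
    by case: (i) => // k; rewrite onth_map; case: onth.
  case: i Hi ui => [|i] Hi ui /=; first by [].
  by rewrite (onth_if End) (ltnW Hi).
rewrite -[pconf _ _ _ _]/(ca_step (fun j => pstep (cs t.+1 j)) (pconf verifier u cs t.+1)).
rewrite onth_ca_step (IH i Hi) [LHS]/=; congr (Some (inr _)).
have -> : obind state_cell (if i is k.+1 then onth (pconf verifier u cs t.+1) k else None)
   = if i is k.+1 then Some (cell_at t k) else None.
  by case: (i) Hi => // k Hk; rewrite IH //; lia.
have -> : obind state_cell (onth (pconf verifier u cs t.+1) i.+1)
   = if i.+1 < N then Some (cell_at t i.+1) else None.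
  case: ltnP => Hi2; first by rewrite IH.
  by rewrite onth_default // size_pconf.
rewrite {2}/cell_at; congr PCell.
- by case: i Hi => [|i] Hi /=.
- case: ltnP => Hi2 /=; first by rewrite addSnnS.
  by rewrite onth_default //; lia.
- case: ifP => //= _.
  case: i Hi => [|i] Hi //=.
  by case: (obind _ _) => [q|].
- rewrite /sim_at /=; congr simstep; first by case: (i).
  by case: ifP.
Qed.

Lemma acc_at0 : u <> [::] -> paca_acc_at verifier u cs 0 = false.
Proof. by case: u. Qed.

Lemma acc_atS t :
  paca_acc_at verifier u cs t.+1 <->
  (forall i, i < N -> paccept (inr (cell_at t i))).
Proof.
rewrite /paca_acc_at; split.
  move=> /allP H i Hi; apply: (H (inr (cell_at t i))).
  by apply/onthP; exists i; exact: pconf_cell.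
move=> H; apply/allP => q /onthP [i Ei].
have Hi : i < N by rewrite -(size_pconf t.+1) -onthTE Ei.
by have := H i Hi; rewrite pconf_cell // in Ei; case: Ei => ->.
Qed.

Variables (x : seq bool) (s : nat).
Hypothesis uE : u = hist G x s.

Lemma sim_initE j : j < N ->
  let c := init_sim (j == 0) (nth End u j) in
  let c0 := pair_conf0 M x in
  [/\ forall i, cur c i = (c0.2 i (Z.of_nat j), c0.2 i (- Z.of_nat j)%Z),
      fresh c = false
    & ctl c = if j is 0 then Some (c0.1, None) else None].
Proof.
move=> Hj c c0; split=> //; last by rewrite /c; case: (j).
move=> i; rewrite ffunE.
set v := (X in (X, _)).
have vE : v = pair_sym x i (Z.of_nat j).
  rewrite /v /pair_sym Nat2Z.id.
  have -> : (0 <=? Z.of_nat j)%Z by apply/Z.leb_le; lia.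
  have := @onth_hist_bit G x s j; have := @onth_hist_cell G x s j.
  rewrite -uE (onth_if End) Hj; case: (ltngtP (size x) j) => Hjx H1 H2.
  - have [|g [o [->]]] := H1; first by lia.
    by rewrite ifF //; apply/negP => /and3P[_ _ /Z.ltb_lt]; lia.
  - have := H2 isT; rewrite (onth_if false) Hjx => -[->].
    have -> : (Z.of_nat j <? Z.of_nat (size x))%Z by apply/Z.ltb_lt; lia.
    by rewrite /= andbT.
  - have := H2 isT; rewrite onth_default; last by rewrite Hjx.
    case=> ->; rewrite ifF //; apply/negP => /and3P[_ _ /Z.ltb_lt]; lia.
rewrite vE; congr pair; rewrite -/v vE {v vE}; case: (j) => [|k]; first by [].
rewrite /c0 /= /pair_sym ifF //; apply/negP => /and3P[_ /Z.leb_le]; lia.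
Qed.

Definition copy_acc n :=
  (cstate (trun M x (fun r => cs r.*2.+1 0) n) == tqacc M) ||
  (cstate (trun M x (fun r => cs r.*2.+2 0) n) == tqacc M).

(** Before time [2n] the simulated state is that of [t/2] machine steps, and an accepting one is
    final because it halts; from [2n] on the state is frozen. The condition [n < N] keeps the error
    from the right end away until then. *)
Lemma sim_state n t : n < N ->
  thalted (trun M x (fun r => cs r.*2.+1 0) n) ->
  thalted (trun M x (fun r => cs r.*2.+2 0) n) ->
  exists q, omap fst (ctl (sim_at t 0)) = Some q /\
    (accepting_pair q -> copy_acc n) /\ (n.*2 <= t -> accepting_pair q = copy_acc n).
Proof.
move=> Hn h1 h2.
set b := (fun t j => cs t.+1 j).
have N0 : 0 < N by lia.
have stE r : (rrun (pair_conf0 M x) (b^~ 0) r).1 =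
    (cstate (trun M x (fun r => cs r.*2.+1 0) r),
     cstate (trun M x (fun r => cs r.*2.+2 0) r)).
  by have [] := @rrun_pair M x (b^~ 0) r.
case: (leqP n.*2 t) => Ht.
  exists (rrun (pair_conf0 M x) (b^~ 0) n).1; split.
    apply: (sim_state_halt sim_initE (hlt := fun q => halted_state q.1 && halted_state q.2)) => //.
    - move=> b1 b2 [q1 q2] r /andP[/= hq1 hq2].
      by rewrite /single_delta hq1 hq2.
    - by rewrite stE; apply/andP; split; [exact: h1 | exact: h2].
  by rewrite stE.
exists (rrun (pair_conf0 M x) (b^~ 0) t./2).1; split.
  by apply: (@sim_state_exact _ N b _ _ sim_initE t) => //; lia.
split; last by move=> H; lia.
have Hm : t./2 <= n by lia.
rewrite stE /accepting_pair /copy_acc /= => /orP[] E; apply/orP; [left|right].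
  by rewrite (trun_halt_stable Hm) // /thalted E.
by rewrite (trun_halt_stable Hm) // /thalted E.
Qed.

Lemma verifier_accepts n t : n < N ->
  thalted (trun M x (fun r => cs r.*2.+1 0) n) ->
  thalted (trun M x (fun r => cs r.*2.+2 0) n) ->
  gacc (gconf G (size x) s).1 -> copy_acc n ->
  size (gconf G (size x) s).2 <= t -> n.*2 <= t ->
  paca_acc_at verifier u cs t.+1.
Proof.
move=> Hn h1 h2 Ga Hc Ht1 Ht2; apply/acc_atS => i Hi /=.
have -> : local_at i.
  rewrite /local_at (onth_if End) Hi; apply: (local_complete uE Ga).
  by rewrite (onth_if End) Hi.
rewrite (chk_complete uE) // eqxx /=.
case: (posnP i) => [-> | i0].
  have [q [E [_ H]]] := sim_state t Hn h1 h2.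
  by move: E; case: (ctl _) => [[q' o]|] //= [->]; rewrite H.
by rewrite (ctl_cell _ sim_initE) ?i0.
Qed.

Lemma verifier_copy_acc n t : n < N ->
  thalted (trun M x (fun r => cs r.*2.+1 0) n) ->
  thalted (trun M x (fun r => cs r.*2.+2 0) n) ->
  paca_acc_at verifier u cs t -> copy_acc n.
Proof.
move=> Hn h1 h2; case: t => [|t].
  by rewrite acc_at0 // => u0; move: Hn; rewrite u0.
move/acc_atS/(_ 0); case: (posnP N) => [N0|N0 /(_ isT)]; first lia.
move=> /= /andP[_].
have [q [E [H _]]] := sim_state t Hn h1 h2.
by move: E; case: (ctl _) => [[q' o]|] //= [->].
Qed.

End Run.

Lemma verifier_valid u cs t : u <> [::] -> paca_acc_at verifier u cs t ->
  exists x s, u = hist G x s /\ gacc (gconf G (size x) s).1.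
Proof.
move=> u0; case: t => [|t]; first by rewrite acc_at0.
move/acc_atS => H; apply: (chk_sound u0).
  move=> p a Hp; have Hi : p < size u by rewrite -onthTE Hp.
  move: (H p Hi) => /= /andP[+ _]; case: ifP => //.
  by rewrite /local_at Hp.
move=> p Hi; exists t; move: (H p Hi) => /= /andP[+ _].
by case: ifP => // _ /eqP.
Qed.

End Verifier.

(** * Acceptance probability *)

Section Restriction.

Variables (X Y : finType) (h : Y -> X).
Hypothesis h_inj : injective h.

Definition restrict (f : {ffun X -> bool}) : {ffun Y -> bool} := [ffun y => f (h y)].

(** Adding modulo 2 the extension of [g] by zero maps one fibre onto the other. *)
Lemma card_restrict_fiber g :
  \sum_(f | restrict f == g) 1 = \sum_(f | restrict f == [ffun=> false]) 1.
Proof.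
pose e x := if [pick y | h y == x] is Some y then g y else false.
pose F (f : {ffun X -> bool}) : {ffun X -> bool} := [ffun x => f x (+) e x].
have eh y : e (h y) = g y.
  by rewrite /e; case: pickP => [y' /eqP/h_inj -> //|/(_ y)]; rewrite eqxx.
have FK : involutive F by move=> f; apply/ffunP => x; rewrite !ffunE addbK.
rewrite (reindex_inj (inv_inj FK)); apply: eq_bigl => f.
apply/eqP/eqP => H; apply/ffunP => y; have /ffunP/(_ y) := H; rewrite !ffunE eh.
  by case: (f _); case: (g y).
by move=> ->.
Qed.

(** An equality of two probabilities with denominators cleared: coins outside the image of [h] have
    no influence. *)
Lemma card_restrict (P : pred {ffun Y -> bool}) :
  #|[pred f | P (restrict f)]| * 2 ^ #|Y| = #|P| * 2 ^ #|X|.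
Proof.
set c := \sum_(f | restrict f == [ffun=> false]) 1.
have H (Q : pred {ffun Y -> bool}) : #|[pred f | Q (restrict f)]| = #|Q| * c.
  rewrite -sum1_card (partition_big restrict Q) //= -sum_nat_const.
  apply: eq_bigr => g Qg; rewrite /c -(card_restrict_fiber g).
  by apply: eq_bigl => f; rewrite inE; case: eqP => [->|]; rewrite ?andbT ?andbF.
have := H predT; rewrite [in LHS]cardT -cardE !card_ffun card_bool => ->.
by rewrite H mulnAC -mulnA.
Qed.

End Restriction.

Lemma card_either (Y : finType) (P : pred {ffun Y -> bool}) :
  let n := 2 ^ #|Y| in
  #|[pred g : {ffun Y + Y -> bool} | P (restrict inl g) || P (restrict inr g)]| =
  n * n - (n - #|P|) * (n - #|P|).
Proof.
move=> n; have cardn : #|{ffun Y -> bool}| = n by rewrite card_ffun card_bool.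
pose F (g : {ffun Y + Y -> bool}) := (restrict inl g, restrict inr g).
pose F' (p : {ffun Y -> bool} * {ffun Y -> bool}) : {ffun Y + Y -> bool} :=
  [ffun s => match s with inl y => p.1 y | inr y => p.2 y end].
have FK : cancel F F'.
  by move=> g; apply/ffunP => -[y|y]; rewrite !ffunE.
have F'K : cancel F' F.
  by move=> [p q]; congr pair; apply/ffunP => y; rewrite !ffunE.
set A := [pred g | _].
have := cardC A; rewrite card_ffun card_bool card_sum expnD -/n.
suff -> : #|[predC A]| = (n - #|P|) * (n - #|P|) by move<-; rewrite addnK.
have -> : n - #|P| = #|[predC P]| by rewrite -cardn -(cardC P) addKn.
rewrite -cardX -[RHS](_ : #|[predI codom F & [predX predC P & predC P]]| = _); last first.
  by apply: eq_card => p; rewrite !inE -[p]F'K codom_f.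
rewrite -(card_preim (can_inj FK)).
by apply: eq_card => g; rewrite !inE negb_or.
Qed.

Lemma steps_below_lt T n t : (INR t < T n)%Re -> t < steps_below T n.
Proof.
move=> H; rewrite /steps_below; have [Hu _] := archimed (T n).
have : (IZR (Z.of_nat t) < IZR (up (T n)))%Re by rewrite -INR_IZR_INZ; lra.
by move/lt_IZR => ?; lia.
Qed.

Lemma trun_ext M x cs cs' n : (forall t, t < n -> cs t = cs' t) ->
  trun M x cs n = trun M x cs' n.
Proof.
elim: n => //= n IH H; rewrite H // IH // => t Ht; apply: H; exact: ltnW.
Qed.

Section Decides.

Variables (G : GM) (M : PTM) (NM : nat -> nat) (T : nat -> R).
Variable L : seq bool -> Prop.
Hypothesis haltsM : thalts_within M NM.
Hypothesis yesL : forall x, L x -> 2 ^ NM (size x) <= 2 * tacc_count M x (NM (size x)).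
Hypothesis noL : forall x, ~ L x -> tacc_count M x (NM (size x)) = 0.
Hypothesis bounds : forall x s, gacc (gconf G (size x) s).1 ->
  NM (size x) < size (hist G x s) /\
  (INR (maxn (size (gconf G (size x) s).2) (NM (size x)).*2).+1 < T (size (hist G x s)))%Re.

(** Acceptance on any word shows that it is a history and that a copy accepts with these coins. The
    same coins then also accept at the explicit time of [bounds], however late the given acceptance
    was. *)
Lemma verifier_time : paca_time (verifier G M) T.
Proof.
move=> u u0 cs t Ha.
have u_nil : u <> [::] by case: (u) u0.
have [x [s [uE Ga]]] := verifier_valid u_nil Ha.
have [Hn HT] := bounds Ga; rewrite -uE in Hn HT.
have h1 := haltsM x (fun r => cs r.*2.+1 0).
have h2 := haltsM x (fun r => cs r.*2.+2 0).
have Hc := verifier_copy_acc uE Hn h1 h2 Ha.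
eexists; split; first exact: HT.
by apply: (verifier_accepts uE Hn h1 h2 Ga Hc); rewrite ?leq_maxl ?leq_maxr.
Qed.

Lemma tacc_countP x cs n :
  cstate (trun M x cs n) == tqacc M -> 0 < tacc_count M x n.
Proof.
move=> H; apply/card_gt0P; exists [ffun i : 'I_n => cs i]; rewrite inE.
rewrite (@trun_ext _ _ _ cs) // => t Ht.
by rewrite /tcoins insubT ffunE.
Qed.

Lemma verifier_no u N : 0 < size u -> ~ padded L u ->
  paca_acc_count (verifier G M) u N = 0.
Proof.
move=> u0 HL; apply: eq_card0 => f; rewrite inE /=; apply/negbTE/existsP => -[t Ha].
have u_nil : u <> [::] by case: (u) u0.
have [x [s [uE Ga]]] := verifier_valid u_nil Ha.
have [Hn HT] := bounds Ga; rewrite -uE in Hn.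
have Hc := verifier_copy_acc uE Hn (haltsM x _) (haltsM x _) Ha.
apply: HL; exists x, s; split=> //; apply: Classical_Prop.NNPP => /noL c0.
by case/orP: Hc => /tacc_countP; rewrite c0.
Qed.

Lemma verifier_yes u : padded L u ->
  3 * 2 ^ (steps_below T (size u) * size u) <=
  4 * paca_acc_count (verifier G M) u (steps_below T (size u)).
Proof.
move=> [x [s [uE Ga Lx]]]; set N := steps_below _ _.
have [Hn HT] := bounds Ga; rewrite -uE in Hn HT.
set n := NM (size x) in Hn HT *.
have tN := steps_below_lt HT; rewrite -/N in tN.
have u0 : 0 < size u by lia.
have Hix (i : 'I_n) d : d < 2 -> i.*2.+1 + d < N.
  by have := ltn_ord i; move: tN; rewrite /n; lia.
(* One copy uses the coins of cell 0 at odd steps, the other those at even steps from 2 on; step 0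
   loads the cells. *)
pose h (y : 'I_n + 'I_n) : 'I_N * 'I_(size u) :=
  match y with
  | inl i => (Ordinal (Hix i 0 isT), Ordinal u0)
  | inr i => (Ordinal (Hix i 1 isT), Ordinal u0)
  end.
have h_inj : injective h.
  move=> [i|i] [j|j] [] /= H; try (exfalso; lia).
    by congr inl; apply: val_inj => /=; lia.
  by congr inr; apply: val_inj => /=; lia.
pose P : pred {ffun 'I_n -> bool} := fun g => cstate (trun M x (tcoins g) n) == tqacc M.
have aP : #|P| = tacc_count M x n by [].
have accE : paca_acc_count (verifier G M) u N =
  #|[pred f | [pred g : {ffun 'I_n + 'I_n -> bool} |
        P (restrict inl g) || P (restrict inr g)] (restrict h f)]|.
  apply: eq_card => f; rewrite !inE.
  have Hc : copy_acc M (coins_of f) x n =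
     P (restrict inl (restrict h f)) || P (restrict inr (restrict h f)).
    rewrite /copy_acc /P /=; congr (_ || _).
      rewrite (@trun_ext _ _ _ (tcoins (restrict inl (restrict h f)))) // => t Ht.
      rewrite /tcoins insubT !ffunE /= /coins_of.
      by have Ht2 := Hix (Ordinal Ht) 0 isT; rewrite addn0 in Ht2; rewrite !insubT /=;
         congr (f (_, _)); apply: val_inj => /=; rewrite ?addn0.
    rewrite (@trun_ext _ _ _ (tcoins (restrict inr (restrict h f)))) // => t Ht.
    rewrite /tcoins insubT !ffunE /= /coins_of.
    by have Ht2 := Hix (Ordinal Ht) 1 isT; rewrite addn1 in Ht2; rewrite !insubT /=;
       congr (f (_, _)); apply: val_inj => /=; rewrite ?addn1.
  rewrite -Hc; apply/existsP/idP => [[t]|Hca].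
    exact: (verifier_copy_acc uE Hn (haltsM x _) (haltsM x _)).
  exists (Ordinal tN).
  by apply: (verifier_accepts uE Hn (haltsM x _) (haltsM x _) Ga Hca);
     rewrite ?leq_maxl ?leq_maxr.
have := card_restrict h_inj [pred g : {ffun 'I_n + 'I_n -> bool} |
        P (restrict inl g) || P (restrict inr g)].
rewrite -accE (card_either P) card_sum card_prod !card_ord expnD aP.
have := yesL Lx; rewrite -/n; set a := tacc_count _ _ _; set A := paca_acc_count _ _ _.
have : a <= 2 ^ n by rewrite /a -aP; apply: leq_trans (max_card _) _; rewrite card_ffun card_bool card_ord.
have : 0 < 2 ^ n by rewrite expn_gt0.
move: (2 ^ n) (2 ^ (N * size u)) a A => m B a A m0 am a2 E.
(* Each copy fails on at most half of its coins, since [m <= 2 * a]; both fail with probability at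
   most 1/4. *)
have H : 3 * (m * m) <= 4 * (m * m - (m - a) * (m - a)) by nia.
rewrite -(leq_pmul2l (m := m * m)) ?muln_gt0 ?m0 //.
have := leq_mul H (leqnn B); lia.
Qed.

(** Since 3/4 exceeds both 1/2 and 2/3 and non-members are never accepted, one automaton serves both
    kinds of error. *)
Lemma verifier_decides k : paca_decides k (verifier G M) T (padded L).
Proof.
split; first exact: verifier_time.
move=> u u0 N acc tot.
have no : ~ padded L u -> acc = 0 by exact: verifier_no.
have yes : padded L u -> 3 * tot <= 4 * acc by exact: verifier_yes.
by case: k; split=> // H; rewrite ?(no H) //; have := yes H; lia.
Qed.

End Decides.

(** * Deciding the padded word deterministically *)

Section Counter.

Variable E : nat.
Notation digit := 'I_E.+1.

Definition inc_digit (c : bool) (d : digit) : digit :=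
  if c then (if d == ord_max then ord0 else inord d.+1) else d.

Fixpoint inc (c : bool) (ds : seq digit) : bool * seq digit :=
  if ds is d :: ds' then
    let p := inc (c && (d == ord_max)) ds' in (p.1, inc_digit c d :: p.2)
  else (c, [::]).

Definition digits_val (ds : seq digit) := foldr (fun (d : digit) v => d + E.+1 * v) 0 ds.

Lemma size_inc c ds : size (inc c ds).2 = size ds.
Proof. by elim: ds c => //= d ds IH c; rewrite IH. Qed.

Lemma digits_val_lt ds : digits_val ds < E.+1 ^ size ds.
Proof. by elim: ds => //= d ds IH; rewrite expnS; have := ltn_ord d; nia. Qed.

Lemma inc_val c ds :
  digits_val (inc c ds).2 + E.+1 ^ size ds * (inc c ds).1 = digits_val ds + c.
Proof.
elim: ds c => [|d ds IH] c /=; first by rewrite mul1n.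
have {}IH := IH (c && (d == ord_max)); rewrite expnS.
have -> : inc_digit c d + E.+1 * digits_val (inc (c && (d == ord_max)) ds).2 +
    E.+1 * E.+1 ^ size ds * (inc (c && (d == ord_max)) ds).1 =
  inc_digit c d + E.+1 * (digits_val ds + (c && (d == ord_max))).
  by rewrite -IH mulnDr mulnA addnA.
rewrite /inc_digit; case: c {IH} => /=; last by rewrite addn0 addn0.
case: eqP => [->|ne] /=; first by lia.
have lt : d < E.
  by have := ltn_ord d; case: (ltngtP d E) => //; [lia | move=> e; case: ne; apply: val_inj].
by rewrite inordK; lia.
Qed.

Lemma digits_val0 n : digits_val (nseq n ord0) = 0.
Proof. by elim: n => //= n ->; rewrite muln0. Qed.

End Counter.

(** [Simc] holds the state of a cell of [D], the state of its left neighbour as noted by the forward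
    sweep, and a clock digit if the cell belongs to the clock. *)
Inductive tcell (G : GM) (D : DCA (letter G)) (E : nat) :=
  | Raw of bool
  | Gen of letter G & bool
  | Simc of dQ D & option (dQ D) & option 'I_E.+1.

Arguments Raw {G D E}.
Arguments Gen {G D E}.
Arguments Simc {G D E}.

Inductive tstate (G : GM) (D : DCA (letter G)) :=
  | Start
  | Seek of bQ G
  | Next of bQ G & bG G
  | Done of bQ G & bG G
  | Ret of bQ G & bG G
  | App of bQ G & bG G
  | AppLast of bQ G & bG G
  | AppMore of bQ G & bG G & bG G
  | Wait of bQ G & bG G
  | Conv of option bool
  | Fwd of option (dQ D) & bool & bool
  | Bwd of option (dQ D)
  | Verdict of bool.

Arguments Start {G D}.
Arguments Seek {G D}.
Arguments Next {G D}.
Arguments Done {G D}.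
Arguments Ret {G D}.
Arguments App {G D}.
Arguments AppLast {G D}.
Arguments AppMore {G D}.
Arguments Wait {G D}.
Arguments Conv {G D}.
Arguments Fwd {G D}.
Arguments Bwd {G D}.
Arguments Verdict {G D}.

Section SolverFinite.

Variables (G : GM) (D : DCA (letter G)) (E : nat).

Definition tcell_code (c : tcell D E) :
    bool + letter G * bool + dQ D * option (dQ D) * option 'I_E.+1 :=
  match c with
  | Raw b => inl (inl b) | Gen a m => inl (inr (a, m)) | Simc q l k => inr (q, l, k)
  end.
Definition tcell_decode
    (c : bool + letter G * bool + dQ D * option (dQ D) * option 'I_E.+1) : tcell D E :=
  match c with
  | inl (inl b) => Raw b | inl (inr (a, m)) => Gen a m | inr (q, l, k) => Simc q l k
  end.
Lemma tcell_codeK : cancel tcell_code tcell_decode.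
Proof. by case. Qed.
HB.instance Definition _ := Finite.copy (tcell D E) (can_type tcell_codeK).

Definition tstate_code (s : tstate D) :
    'I_13 * option (bQ G) * option (bG G) * option (bG G) * option (dQ D) *
    option bool * bool :=
  match s with
  | Start => (@Ordinal 13 0 isT, None, None, None, None, None, false)
  | Seek q => (@Ordinal 13 1 isT, Some q, None, None, None, None, false)
  | Next q g => (@Ordinal 13 2 isT, Some q, Some g, None, None, None, false)
  | Done q g => (@Ordinal 13 3 isT, Some q, Some g, None, None, None, false)
  | Ret q g => (@Ordinal 13 4 isT, Some q, Some g, None, None, None, false)
  | App q g => (@Ordinal 13 5 isT, Some q, Some g, None, None, None, false)
  | AppLast q g => (@Ordinal 13 6 isT, Some q, Some g, None, None, None, false)
  | AppMore q g h => (@Ordinal 13 7 isT, Some q, Some g, Some h, None, None, false)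
  | Wait q g => (@Ordinal 13 8 isT, Some q, Some g, None, None, None, false)
  | Conv o => (@Ordinal 13 9 isT, None, None, None, None, o, false)
  | Fwd l c f => (@Ordinal 13 10 isT, None, None, None, l, Some c, f)
  | Bwd l => (@Ordinal 13 11 isT, None, None, None, l, None, false)
  | Verdict b => (@Ordinal 13 12 isT, None, None, None, None, Some b, false)
  end.
Definition tstate_decode (c : 'I_13 * option (bQ G) * option (bG G) *
    option (bG G) * option (dQ D) * option bool * bool) : tstate D :=
  let: (n, q, g, h, l, o, f) := c in
  match val n, q, g, h with
  | 1, Some q, _, _ => Seek q
  | 2, Some q, Some g, _ => Next q g
  | 3, Some q, Some g, _ => Done q g
  | 4, Some q, Some g, _ => Ret q g
  | 5, Some q, Some g, _ => App q g
  | 6, Some q, Some g, _ => AppLast q g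
  | 7, Some q, Some g, Some h => AppMore q g h
  | 8, Some q, Some g, _ => Wait q g
  | 9, _, _, _ => Conv o
  | 10, _, _, _ => Fwd l (o == Some true) f
  | 11, _, _, _ => Bwd l
  | 12, _, _, _ => Verdict (o == Some true)
  | _, _, _, _ => Start
  end.
Lemma tstate_codeK : cancel tstate_code tstate_decode.
Proof.
by case=> [|?|? ?|? ?|? ?|? ?|? ?|? ? ?|? ?|?|? [] ?|?|[]].
Qed.
HB.instance Definition _ := Finite.copy (tstate D) (can_type tstate_codeK).

End SolverFinite.

Section Solver.

Variables (G : GM) (D : DCA (letter G)) (E : nat) (clk : pred (bG G)).

(* The marked letter is the next one to be read by [G]: every round trip appends
   its image at the right end and moves the mark one letter to the left, or to
   the end when a row is complete.  Afterwards each round trip simulates one step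
   of [D] and increments a counter held by the cells of the last row that
   satisfy [clk]. *)
Definition solver_mu (s : tstate D) (c : tcell D E) : tstate D * tcell D E :=
  match s, c with
  | Start, Raw b => (Start, Gen (Bit b) false)
  | Seek q, Gen a true => (Next (bmu q (sym a)).1 (bmu q (sym a)).2, Gen a false)
  | Next q g, Gen a _ =>
    if is_last a then (Done q g, Gen a false) else (Ret q g, Gen a true)
  | Conv o, Gen a _ =>
    let o' := match o with
              | None => Some true
              | Some b => Some (b && ~~ is_last a)
              end in
    (Conv o', Simc (dinp D a) None
       (if (o' == Some true) && clk (sym a) then Some ord0 else None))
  | Fwd l carry f, Simc q _ k =>
    (Fwd (Some q) (if k is Some d then carry && (d == ord_max) else carry)
         (f || ((l == None) && dacc q)),
     Simc q l (omap (inc_digit carry) k))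
  | Bwd r, Simc q l k => (Bwd (Some q), Simc (ddelta l q r) l k)
  | _, _ => (s, c)
  end.

Definition after_row (q : bQ G) : tstate D := if gacc q then Conv None else Seek q.

(** [AppMore] and [Wait] spend an extra round trip on a cell appended by [bturn], so each letter
    after the first row costs exactly two sweeps. A carry left over at the end of [Fwd] means that
    the clock has run out. *)
Definition solver_turn (s : tstate D) : tstate D * option (tcell D E) :=
  match s with
  | Start => (Seek (gq0 G), Some (Gen End true))
  | Next q g | Done q g =>
    let t := bturn q in
    (if t.2 is Some h then AppMore t.1 g h else AppLast t.1 g, None)
  | Ret q g => (App q g, None)
  | App q g => (Seek q, Some (Gen (Cell g None) false))
  | AppLast q g => (after_row q, Some (Gen (Cell g (Some q)) true))
  | AppMore q g h => (Wait q h, Some (Gen (Cell g None) false))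
  | Wait q h => (AppLast q h, None)
  | Conv _ => (Fwd None true false, None)
  | Fwd _ carry f =>
    (if f then Verdict true else if carry then Verdict false else Bwd None, None)
  | Bwd _ => (Fwd None true false, None)
  | _ => (s, None)
  end.

Definition solver : BM := Build_BM solver_mu solver_turn.

Definition verdict (s : tstate D) : option bool :=
  if s is Verdict b then Some b else None.

Notation step := (@bstep solver).
Notation gens := (map (fun a => Gen a false : tcell D E)).

Lemma pass_fix (s : tstate D) (P : pred (tcell D E)) l :
  (forall c, P c -> solver_mu s c = (s, c)) -> all P l ->
  pass (B := solver) s l = (s, l).
Proof. by move=> H; elim: l => //= c l IH /andP[/H -> /IH ->]. Qed.

Lemma pass_gens (s : tstate D) u :
  match s with Seek _ | Ret _ _ | Done _ _ | App _ _ | AppLast _ _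
    | AppMore _ _ _ | Wait _ _ => true | _ => false end ->
  pass (B := solver) s (gens u) = (s, gens u).
Proof.
move=> H; apply: (pass_fix (P := fun c => if c is Gen _ false then true else false)).
  by case=> // a []; case: s H.
by elim: u.
Qed.

Lemma pass_gens_mark (s : tstate D) u a v :
  match s with Ret _ _ | Done _ _ | App _ _ | AppLast _ _
    | AppMore _ _ _ | Wait _ _ => true | _ => false end ->
  pass (B := solver) s (gens u ++ Gen a true :: gens v) =
    (s, gens u ++ Gen a true :: gens v).
Proof.
move=> H; apply: (pass_fix (P := fun c => if c is Gen _ _ then true else false)).
  by case=> // b m; case: s H.
by rewrite all_cat /=; apply/andP; split; [elim: u | elim: v].
Qed.

Lemma gen_inner q pre b a post : ~~ is_last b ->
  iter 2 step (Seek q, gens (rcons pre b) ++ Gen a true :: gens post) =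
  (Seek (bmu q (sym a)).1,
   gens pre ++ Gen b true :: gens (a :: rcons post (Cell (bmu q (sym a)).2 None))).
Proof.
move=> nb; rewrite /= {2}/bstep /= rev_cat rev_cons -map_rev cat_rcons pass_cat.
rewrite pass_gens //= map_rcons rev_rcons /= (negbTE nb) /=.
rewrite -map_rev pass_gens //= cats0 /bstep /=.
rewrite rev_cat !rev_cons -!map_rev !revK !cat_rcons.
rewrite -[[:: Gen a false & gens post]]/(gens (a :: post)) pass_gens_mark //=.
by rewrite map_rcons -cats1 -catA.
Qed.

Lemma gen_last q pre a post :
  (pre = [::] \/ exists pre' b, pre = rcons pre' b /\ is_last b) ->
  let p := bmu q (sym a) in
  let t := bturn p.1 in
  iter 2 step (Seek q, gens pre ++ Gen a true :: gens post) =
  if t.2 is Some h then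
    (Wait t.1 h, gens (pre ++ a :: rcons post (Cell p.2 None)))
  else
    (after_row t.1, gens (pre ++ a :: post) ++ [:: Gen (Cell p.2 (Some t.1)) true]).
Proof.
move=> Hpre p t.
have -> : iter 2 step (Seek q, gens pre ++ Gen a true :: gens post) =
    step (if t.2 is Some h then AppMore t.1 p.2 h else AppLast t.1 p.2,
          gens (rev (pre ++ a :: post))).
  rewrite /=; congr (step _).
  rewrite /bstep /= rev_cat rev_cons -map_rev cat_rcons pass_cat pass_gens //= -/p.
  rewrite -map_rev rev_cat rev_cons cat_rcons map_cat /=.
  case: Hpre => [->|[pre' [b [-> lb]]]]; first by rewrite /= cats0.
  by rewrite rev_rcons /= lb pass_gens //= cats0.
rewrite /bstep /= -map_rev revK pass_gens; last by case: t.2.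
by case: t.2 => [h|] //=; rewrite !map_cat /= map_rcons -cats1 -catA.
Qed.

Definition tape_of (h : seq (letter G)) : seq (tcell D E) :=
  if rev h is a :: h' then gens (rev h') ++ [:: Gen a true] else [::].

Lemma tape_of_rcons h a : tape_of (rcons h a) = gens h ++ [:: Gen a true].
Proof. by rewrite /tape_of rev_rcons revK. Qed.

Lemma size_consE (T : Type) (x : T) s : size (x :: s) = (size s).+1.
Proof. by []. Qed.

(** The mark moves left while images pile up at the right end, so the induction peels the row from
    the right and shifts the letters already read into [post]. *)
Lemma gen_row s a : forall q pre post,
  (pre = [::] \/ exists pre' b, pre = rcons pre' b /\ is_last b) ->
  all (predC (@is_last G)) s ->
  let r := rev (map (@sym G) (rcons s a)) in
  forall n, n = 2 * size (next_row q r) ->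
  iter n step
    (Seek q, gens (pre ++ s) ++ Gen a true :: gens post) =
  (after_row (bturn (pass q r).1).1, tape_of (pre ++ rcons s a ++ post ++ next_row q r)).
Proof.
elim/last_ind: s a => [|s b IH] a q pre post Hpre.
  move=> _ r n; rewrite cats0 /next_row /= size_enc => nE.
  have := gen_last q a post Hpre; cbv zeta; case Et: (bturn _).2 nE => [h|] nE E1; rewrite [size _]/= in nE.
    rewrite (_ : pre ++ _ = rcons (pre ++ a :: rcons post (Cell (bmu q (sym a)).2 None))
        (Cell h (Some (bturn (bmu q (sym a)).1).1))); last first.
      by rewrite -!cats1 -!catA /= -catA.
    rewrite tape_of_rcons nE (iterD 2 2) E1 /= /bstep /= -map_rev pass_gens //= cats0.
    by rewrite -map_rev revK pass_gens.
  rewrite (_ : pre ++ _ = rcons (pre ++ a :: post)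
      (Cell (bmu q (sym a)).2 (Some (bturn (bmu q (sym a)).1).1))); last first.
    by rewrite -!cats1 -!catA.
  by rewrite tape_of_rcons nE E1.
rewrite all_rcons; cbv zeta => /andP[/= nb Hs] n.
have [c [r Er]] : exists c r, rev (map (@sym G) (rcons s b)) = c :: r.
  by rewrite map_rcons rev_rcons; do 2 eexists.
rewrite map_rcons rev_rcons Er next_row_cons size_consE -Er mulnS addnC => ->; rewrite iterD.
rewrite -rcons_cat gen_inner //.
have := IH b (bmu q (sym a)).1 pre (a :: rcons post (Cell (bmu q (sym a)).2 None)) Hpre Hs.
cbv zeta => /(_ _ erefl) ->; rewrite Er; congr (_, tape_of _).
by rewrite -!cats1 -!catA /= -catA.
Qed.

Lemma row_rcons x t : exists s a, [/\ row G x t = rcons s a, is_last a & all (predC (@is_last G)) s].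
Proof.
have := map_ann_row G x t; have := size_row G x t; have := size_gconf G (size x) t.
case/lastP: (row G x t) => [|s a]; first by move=> /[swap] <-.
move=> _ _; rewrite map_rcons size_rcons => /rcons_inj [Es Ea].
exists s, a; split=> //; first by rewrite /is_last Ea.
elim: s Es => //= b s IH [Eb /IH ->].
by rewrite /is_last Eb.
Qed.

(** The solver enters [Seek] after the first row without testing acceptance, hence the separate case
    [t = 0]. *)
Lemma gen_hist x t :
  (forall i, 0 < i < t -> ~~ gacc (gconf G (size x) i).1) -> 
  iter (2 * (size (hist G x t) - size (hist G x 0))) step (Seek (gq0 G), tape_of (hist G x 0)) =
  (if t is 0 then Seek (gq0 G) else after_row (gconf G (size x) t).1, tape_of (hist G x t)).
Proof.
elim: t => [|t IH] Hna; first by rewrite subnn.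
have Hna' i : 0 < i < t -> ~~ gacc (gconf G (size x) i).1.
  by move=> Hi; apply: Hna; lia.
have {}IH := IH Hna'.
have [rest E0] := hist_prefix G x (leq0n t).
have sz : size (hist G x 0) <= size (hist G x t) by rewrite E0 size_cat leq_addr.
have szS : size (hist G x t.+1) = size (hist G x t) + size (row G x t.+1) by rewrite /= size_cat.
rewrite szS addnC -addnBA // mulnDr iterD IH.
have -> : (if t is 0 then Seek (gq0 G) else after_row (gconf G (size x) t).1) = Seek (gconf G (size x) t).1.
  case: (t) Hna => // t' Hna; rewrite /after_row (negbTE (Hna t'.+1 _)) //; lia.
have [pre [hE Hpre]] := hist_pre G x t.
have [s [a [rE la Hs]]] := row_rcons x t.
have := @gen_row s a (gconf G (size x) t).1 pre [::] Hpre Hs.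
cbv zeta; rewrite -rE map_sym_row next_row_row => /(_ _ erefl).
rewrite -tape_of_rcons rcons_cat -rE -hE => ->.
by rewrite cat0s catA -hE.
Qed.

Notation simcell := (dQ D * option (dQ D) * option 'I_E.+1)%type.

Definition sim_cell (p : simcell) : tcell D E := Simc p.1.1 p.1.2 p.2.

Definition states (s : seq simcell) : seq (dQ D) := [seq p.1.1 | p <- s].

Definition clock (s : seq simcell) : seq 'I_E.+1 := pmap snd s.

Fixpoint fwd (l : option (dQ D)) (c : bool) (s : seq simcell) : seq simcell :=
  if s is p :: s' then
    (p.1.1, l, omap (inc_digit c) p.2)
    :: fwd (Some p.1.1) (if p.2 is Some d then c && (d == ord_max) else c) s'
  else [::].

Fixpoint bwd (s : seq simcell) : seq simcell :=
  if s is p :: s' then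
    (ddelta p.1.2 p.1.1 (if s' is p' :: _ then Some p'.1.1 else None), p.1.2, p.2)
    :: bwd s'
  else [::].

Lemma pass_fwd l c f s : exists l',
  pass (B := solver) (Fwd l c f) (map sim_cell s) =
  (Fwd l' (inc c (clock s)).1
     (f || ((l == None) && (if s is p :: _ then dacc p.1.1 else false))),
   map sim_cell (fwd l c s)).
Proof.
elim: s l c f => [|p s IH] l c f /=.
  by exists l; rewrite andbF orbF.
have [l' ->] := IH (Some p.1.1) (if p.2 is Some d then c && (d == ord_max) else c)
  (f || (l == None) && dacc p.1.1).
by exists l'; rewrite /= orbF /clock; case: p => [[q o] [d|]].
Qed.

Lemma pass_bwd s :
  pass (B := solver) (Bwd None) (rev (map sim_cell s)) =
  (Bwd (if s is p :: _ then Some p.1.1 else None), rev (map sim_cell (bwd s))).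
Proof.
elim: s => [|p s IH] //=; rewrite !rev_cons -!cats1 pass_cat IH /=.
by case: s {IH} => [|p' s].
Qed.

Lemma clock_fwd l c s : clock (fwd l c s) = (inc c (clock s)).2.
Proof. by elim: s l c => //= -[[q o] [d|]] s IH l c; rewrite /clock /= -/(clock _) IH. Qed.

Lemma clock_bwd s : clock (bwd s) = clock s.
Proof. by elim: s => //= -[[q o] [d|]] s IH; rewrite /clock /= -/(clock _) IH. Qed.

(** The forward sweep stores the old state of each left neighbour and the backward sweep carries
    that of the right neighbour, so cells can be updated in place. *)
Lemma states_bwd_fwd c s :
  states (bwd (fwd None c s)) = ca_step (fun _ => @ddelta _ D) (states s).
Proof.
apply: eq_from_onth => i; rewrite onth_ca_step.
have H : forall l c, onth (states (bwd (fwd l c s))) i =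
  omap (fun q => ddelta (if i is k.+1 then onth (states s) k else l) q
                   (onth (states s) i.+1)) (onth (states s) i).
  elim: s i => [|p s IH] i l c' /=; first by rewrite !onth0n.
  case: i => [|i]; last first.
    by rewrite [LHS]IH; case: i => [|i] //=; case: s {IH}.
  by congr (Some (ddelta _ _ _)); case: s {IH}.
by rewrite H; case: i {H} => [|i].
Qed.

(** The clock shows the number of simulated steps and [k] is what remains before overflow, so the
    verdict covers exactly the times below the capacity. *)
Lemma sim_run h k : forall t s, 0 < k -> states s = dconf D h t ->
  t + k = E.+1 ^ size (clock s) -> digits_val (clock s) = t ->
  exists2 n, n <= 2 * k &
    let c := iter n step (Fwd None true false, rev (map sim_cell s)) in
    c.1 = Verdict (has (dca_acc_at D h) (iota t k)) /\ size c.2 = size s.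
Proof.
elim: k => // k IH t s _ Hs Ht Hv.
have step1 : step (Fwd None true false, rev (map sim_cell s)) =
   (if dca_acc_at D h t then Verdict true
    else if (inc true (clock s)).1 then Verdict false else Bwd None,
    map sim_cell (fwd None true s)).
  rewrite /bstep /= revK; have [l' ->] := pass_fwd None true false s.
  by rewrite /= cats0 /dca_acc_at -Hs; congr (_, _); case: (s).
have sz : size (fwd None true s) = size s.
  by elim: (s) (None) (true) => //= p s' IHs l c; rewrite IHs.
rewrite [has _ _]/=; case Ea: (dca_acc_at D h t) step1 => /= step1.
  by exists 1; rewrite // -[iter 1 _ _]/(step _) step1 /= size_map sz.
have Hinc := inc_val true (clock s).
case Ec: (inc true (clock s)).1 step1 Hinc => step1 /= Hinc.
  exists 1; rewrite // -[iter 1 _ _]/(step _) step1 /= size_map sz; split=> //.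
  by have -> : k = 0 by lia.
have step2 : iter 2 step (Fwd None true false, rev (map sim_cell s)) =
   (Fwd None true false, rev (map sim_cell (bwd (fwd None true s)))).
  by rewrite -[iter 2 _ _]/(step (step _)) step1 /bstep /= pass_bwd /= cats0.
have szc : size (clock (bwd (fwd None true s))) = size (clock s).
  by rewrite clock_bwd clock_fwd size_inc.
have [||||n Hn [Hc1 Hc2]] := IH t.+1 (bwd (fwd None true s)).
- have := digits_val_lt (inc true (clock s)).2; rewrite size_inc; lia.
- by rewrite states_bwd_fwd Hs.
- by rewrite szc -Ht addSnnS.
- by rewrite clock_bwd clock_fwd; lia.
exists (n + 2); first lia.
rewrite iterD step2; split; first exact: Hc1.
rewrite [LHS]Hc2.
by rewrite -sz; elim: (fwd _ _ _) => //= p s' ->.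
Qed.

Lemma conv_tape x t :
  exists s, step (Conv None, tape_of (hist G x t)) =
      (Fwd None true false, rev (map sim_cell s)) /\
    states s = map (@dinp _ D) (hist G x t) /\
    clock s = nseq (count clk (gconf G (size x) t).2) ord0.
Proof.
have [pre [hE Hpre]] := hist_pre G x t.
have [r [a [rE la Hr]]] := row_rcons x t.
pose f0 a := (dinp D a, None, None) : simcell.
pose f1 a := (dinp D a, None, if clk (sym a) then Some ord0 else None) : simcell.
have pass0 l : pass (B := solver) (Conv (Some false)) (gens l) =
    (Conv (Some false), map sim_cell (map f0 l)).
  by elim: l => //= b l ->.
have pass1 l : all (predC (@is_last G)) l ->
    pass (B := solver) (Conv (Some true)) (gens l) =
    (Conv (Some true), map sim_cell (map f1 l)).
  by elim: l => //= b l IH /andP[nb Hl]; rewrite nb (IH Hl).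
have pass2 : exists o, pass (B := solver) (Conv (Some true)) (gens (rev pre)) =
    (Conv o, map sim_cell (map f0 (rev pre))).
  case: Hpre => [->|[pre' [b [-> lb]]]]; first by exists (Some true).
  by exists (Some false); rewrite rev_rcons /= lb /= pass0.
exists (map f0 pre ++ map f1 (rcons r a)); split; last split.
- rewrite hE rE -rcons_cat tape_of_rcons /bstep /= rev_cat -map_rev rev_cat map_cat /=.
  rewrite pass_cat /= pass1 ?all_rev //=; have [o ->] := pass2.
  rewrite /= cats0 !map_cat rev_cat -!map_rev rev_rcons /=.
  by rewrite -!map_cat.
- by rewrite /states map_cat -!map_comp hE map_cat rE.
- rewrite /clock pmap_cat -map_sym_row rE.
  have -> : pmap snd (map f0 pre) = [::] by elim: (pre).
  by elim: (rcons r a) => //= b l; case: (clk _) => /= ->.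
Qed.

Variable inp : seq bool.

Lemma solver_run t :
  let n := size inp in
  0 < t -> gacc (gconf G n t).1 -> (forall i, 0 < i < t -> ~~ gacc (gconf G n i).1) ->
  let h := hist G inp t in
  let K := E.+1 ^ count clk (gconf G n t).2 in
  exists2 m, m <= 2 * size h + 2 * K &
    let c := iter m step (Start, rev (map Raw inp)) in
    c.1 = Verdict (has (dca_acc_at D h) (iota 0 K)) /\ size c.2 = size h.
Proof.
move=> n t0 Ga Hna h K.
have E1 : iter 1 step (Start, rev (map Raw inp)) = (Seek (gq0 G), tape_of (hist G inp 0)).
  rewrite /= /bstep /= revK /row tape_of_rcons.
  by have -> : pass (B := solver) Start (map Raw inp) = (Start, gens (map Bit inp))
    by elim: (inp) => //= b l ->.
have E2 := gen_hist Hna.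
have [s [E3 [Hs Hc]]] := conv_tape inp t.
have E3' : step (if t is 0 then Seek (gq0 G) else after_row (gconf G (size inp) t).1,
    tape_of (hist G inp t)) = (Fwd None true false, rev (map sim_cell s)).
  by rewrite -E3 /after_row Ga; case: (t) t0.
have K0 : 0 < K by rewrite expn_gt0.
have [||m Hm [Hm1 Hm2]] := @sim_run h K 0 s K0 Hs.
- by rewrite Hc size_nseq.
- by rewrite Hc digits_val0.
have [pre hE] := hist_prefix G inp (leq0n t).
have sz0 : 0 < size (hist G inp 0) by rewrite /= /row size_rcons.
have szh : size h = size (hist G inp 0) + size pre by rewrite /h hE size_cat.
exists (m + (1 + (2 * (size h - size (hist G inp 0)) + 1))); first by lia.
rewrite iterD (iterD 1) iterD E1 E2 /= [bstep _]E3'; split=> //.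
by rewrite [LHS]Hm2 -(size_map (fun p : simcell => p.1.1)) [size _](congr1 size Hs) size_map.
Qed.

End Solver.

Lemma INR_expn m n : INR (m ^ n) = (INR m ^ n)%Re.
Proof. by elim: n => //= n IH; rewrite expnS mult_INR IH. Qed.

Lemma INR_leq m n : m <= n -> (INR m <= INR n)%Re.
Proof. by move=> H; apply: le_INR; lia. Qed.

Lemma INR_ltn m n : m < n -> (INR m < INR n)%Re.
Proof. by move=> H; apply: lt_INR; lia. Qed.

Lemma nat_above (r : R) : exists n, (r <= INR n)%Re.
Proof.
exists (Z.to_nat (up r)); have [H _] := archimed r.
rewrite INR_IZR_INZ; case: (Z_le_gt_dec 0 (up r)) => Hz.
  by rewrite Z2Nat.id //; lra.
rewrite (_ : Z.to_nat (up r) = 0); last by lia.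
have : (IZR (up r) <= 0)%Re by apply: (IZR_le _ 0); lia.
by rewrite /=; lra.
Qed.

Lemma expn2_above (r : R) : exists n, (r <= INR (2 ^ n))%Re.
Proof.
have [n Hn] := nat_above r; exists n; apply: Rle_trans Hn _.
by apply: INR_leq; rewrite ltnW // ltn_expl.
Qed.

(** * From an automaton for the padded words back to the language *)

Section Padding.

Variables (G : GM) (clk : pred (bG G)).
Variable ts : nat -> nat.
Hypothesis ts_gt0 : forall n, 0 < ts n.
Hypothesis ts_acc : forall n, gacc (gconf G n (ts n)).1.
Hypothesis ts_min : forall n i, 0 < i < ts n -> ~~ gacc (gconf G n i).1.

Definition width n := count clk (gconf G n (ts n)).2.

Definition hist_size n t := \sum_(i < t.+1) size (gconf G n i).2.

Lemma size_hist x t : size (hist G x t) = hist_size (size x) t.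
Proof.
rewrite /hist_size; elim: t => [|t IH]; first by rewrite big_ord1 -[hist G x 0]/(row G x 0) size_row.
by rewrite big_ord_recr -[hist G x t.+1]/(hist G x t ++ row G x t.+1) size_cat IH size_row.
Qed.

Variable kappa : nat.
Hypothesis width_gt0 : forall n, 0 < width n.
Hypothesis hist_bound : forall n, hist_size n (ts n) <= 2 ^ (kappa * width n).

Section Machine.

Variables (D : DCA (letter G)) (e : nat).

Let E := (2 ^ e).-1.

Lemma Raw_inj : injective (@Raw G D E).
Proof. by move=> b b' []. Qed.

Definition solver_tm : PTM :=
  tm_of_bm (B := solver D E clk) Raw_inj Start (@verdict G D).

(** With [w = width n] there are at most [2 * 2^(kappa w) + 2 * 2^(e w)] sweeps of at most
    [2^(kappa w) + 1] steps each; three factors [2^w] absorb the constants. *)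
Definition solver_time n := 2 ^ ((2 * kappa + e + 3) * width n).

Lemma solver_tm_run x cs :
  let h := hist G x (ts (size x)) in
  cstate (trun solver_tm x cs (solver_time (size x))) =
  inr (has (dca_acc_at D h) (iota 0 (2 ^ (e * width (size x))))) :> tQ solver_tm.
Proof.
move=> h; set n := size x in h *.
have EE : E.+1 = 2 ^ e by rewrite prednK // expn_gt0.
have [m Hm [Hm1 Hm2]] := @solver_run G D E clk x (ts n) (ts_gt0 n) (ts_acc n) (@ts_min n).
rewrite -/(width n) EE -expnM -/h in Hm Hm1.
set v := has _ _ in Hm1 *.
pose cf := bconf (B := solver D E clk) (@Raw G D E) Start x.
have cfE i : cf i = iter i (@bstep (solver D E clk)) (Start, rev (map Raw x)) by [].
(* The compiled machine stops at the first verdict, whereas [m] is only a time by which one has been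
   given. Verdicts are permanent, so the two agree. *)
have exm : exists i, verdict (cf i).1 != None by exists m; rewrite cfE Hm1.
case: (ex_minnP exm) => m' Hm' Hmin.
have m'm : m' <= m by apply: Hmin; rewrite cfE Hm1.
have m'0 : 0 < m' by case: (m') Hm'.
case: m' m'0 Hm' Hmin m'm => // m' _ Hm' Hmin m'm.
have [w Hw] : exists w, verdict (cf m'.+1).1 = Some w.
  by case: (verdict _) Hm' => // w _; exists w.
have vE : w = v.
  have st k : (cf (m'.+1 + k)).1 = Verdict w.
    elim: k => [|k IH].
      by rewrite addn0; case: (cf m'.+1).1 Hw => //= b [->].
    rewrite addnS cfE iterS -cfE /bstep IH /=.
    suff -> : pass (B := solver D E clk) (Verdict w) (rev (cf (m'.+1 + k)).2) =
      (Verdict w, rev (cf (m'.+1 + k)).2) by [].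
    by apply: (pass_fix (P := predT)) => //; apply/allP.
  by have := st (m - m'.+1); rewrite subnKC // cfE Hm1 => -[].
have halted := @trun_halted (solver D E clk) (@Raw G D E) Raw_inj Start (@verdict G D) x cs m' w.
have {}halted := halted _ Hw; rewrite -vE -halted; last first.
  move=> i Hi; apply/eqP; apply: contraTT isT => /Hmin.
  by move=> ?; lia.
have Hh : thalted (trun solver_tm x cs (btime (B := solver D E clk) (@Raw G D E) Start x m'.+1)).
  rewrite /thalted halted; first by case: (w).
  move=> i Hi; apply/eqP; apply: contraTT isT => /Hmin.
  by move=> ?; lia.
rewrite (trun_halt_stable _ Hh) //.
have sz i : i <= m -> size (cf i).2 <= size h.
  move=> im; rewrite -Hm2 -cfE -(subnKC im); elim: (m - i) => [|k IH]; first by rewrite addn0.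
  by rewrite addnS; apply: leq_trans IH (size_bstep _).
have bt i : i <= m -> btime (B := solver D E clk) (@Raw G D E) Start x i <= i * (size h).+1.
  elim: i => //= i IH im; rewrite mulSn addnC leq_add ?IH ?ltnS ?sz //; lia.
apply: leq_trans (bt _ m'm) _.
apply: leq_trans (leq_mul m'm (leqnn _)) _.
have hb : size h <= 2 ^ (kappa * width n) by rewrite size_hist; apply: hist_bound.
have w0 := width_gt0 n.
have p1 : 2 <= 2 ^ width n by rewrite -{1}(expn1 2) leq_exp2l.
rewrite /solver_time -/n.
have -> : (2 * kappa + e + 3) * width n =
   kappa * width n + kappa * width n + e * width n + width n + width n + width n by lia.
rewrite !expnD; move: (2 ^ (kappa * width n)) (2 ^ (e * width n)) (2 ^ width n) (size h) hb p1 Hm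
  (expn_gt0 2 (kappa * width n)) (expn_gt0 2 (e * width n)) => a b c s sa c2 ms a0 b0.
rewrite /= in a0 b0.
have ab : a + b <= 2 * (a * b) by nia.
have cc : 4 <= c * c by nia.
have H1 : m <= a * b * (c * c).
  apply: leq_trans (_ : a * b * 4 <= _); last by rewrite leq_mul2l cc orbT.
  lia.
have H2 : s.+1 <= a * c by nia.
apply: leq_trans (leq_mul H1 H2) _; apply: eq_leq.
by lia.
Qed.

End Machine.

Variables (M : PTM) (NM : nat -> nat) (T : nat -> R) (L : seq bool -> Prop).
Variables (k : error_kind) (d : R).
Hypothesis haltsM : thalts_within M NM.
Hypothesis yesL : forall x, L x -> 2 ^ NM (size x) <= 2 * tacc_count M x (NM (size x)).
Hypothesis noL : forall x, ~ L x -> tacc_count M x (NM (size x)) = 0.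
Hypothesis bounds : forall n s, gacc (gconf G n s).1 ->
  NM n < hist_size n s /\
  (INR (maxn (size (gconf G n s).2) (NM n).*2).+1 < T (hist_size n s))%Re.
Hypothesis conv : convertible k T d.

(** A clock in base [2^e] on the [width n] cells outlasts the polynomial bound: [kappa * d'] pays
    for the power of the word length and [j] for the constant [K]. *)
Lemma dca_steps_bound (K : R) : exists e, forall n,
  (bigO K (npow d) (hist_size n (ts n)) <= INR (2 ^ (e * width n)))%Re.
Proof.
have [j Hj] := expn2_above (2 * Rabs K).
have [d' Hd'] := nat_above d.
exists (j + kappa * d') => n.
have hb := hist_bound n; have w0 := width_gt0 n.
set N := hist_size n (ts n) in hb *.
have N1 : 1 <= N.
  by rewrite /N /hist_size big_ord_recl; have := size_gconf G n 0; rewrite /=; lia.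
have NR : (1 <= INR N)%Re by apply: (INR_leq N1).
have Hp : (npow d N <= INR (2 ^ (kappa * d' * width n)))%Re.
  apply: Rle_trans (_ : (INR N ^ d' <= _)%Re).
    rewrite /npow -Rpower_pow; last by lra.
    by apply: Rle_Rpower.
  rewrite -INR_expn; apply: INR_leq; rewrite -mulnA [d' * _]mulnC mulnA expnM.
  by case: (d') => [|d'']; rewrite ?expn0 ?leq_exp2r.
have Hp0 : (0 <= npow d N)%Re by apply: Rlt_le; apply: exp_pos.
rewrite mulnDl expnD mult_INR.
have H1 : (2 * Rabs K <= INR (2 ^ (j * width n)))%Re.
  apply: Rle_trans Hj _; apply: INR_leq; apply: leq_pexp2l => //.
  by rewrite leq_pmulr.
have H2 : (1 <= INR (2 ^ (kappa * d' * width n)))%Re.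
  by apply: (@INR_leq 1); rewrite expn_gt0.
rewrite /bigO; have := Rle_abs K; have := Rabs_pos K.
move: (INR (2 ^ (j * _))) (INR (2 ^ (_ * _ * _))) (npow d N) (Rabs K) Hp Hp0 H1 H2.
move=> a b c r Hp Hp0 H1 H2 r0 Kr.
nra.
Qed.

Theorem padding : exists (kappa' : nat) (M' : PTM), 
  [/\ deterministic M', thalts_within M' (fun n => 2 ^ (kappa' * width n))
    & forall x, L x <->
      cstate (trun M' x (fun _ => false) (2 ^ (kappa' * width (size x)))) = tqacc M'].
Proof.
have [|D [K [Dtime Dacc]]] := conv (C := verifier G M) (L := padded L).
  apply: (verifier_decides haltsM yesL noL) => x s Ga; rewrite size_hist; exact: bounds.
have [e He] := dca_steps_bound K.
exists (2 * kappa + e + 3), (solver_tm D e); split=> //.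
- by move=> x cs; rewrite /thalted (solver_tm_run D e x cs) /=; case: has.
- move=> x; rewrite (solver_tm_run D e x) /=.
  set h := hist G x _.
  have h0 : 0 < size h.
    by rewrite size_hist /hist_size big_ord_recl; have := size_gconf G (size x) 0; rewrite /=; lia.
  have Lh : L x <-> padded L h.
    split=> [Lx|[x' [t [hE _ Lx']]]]; last by rewrite (hist_decode hE).
    by exists x, (ts (size x)); split.
  rewrite Lh (Dacc h h0); split=> [[t Ht]|[/hasP[t _ Ht]]]; last by exists t.
  congr (inr _); apply/hasP; have [t' [Ht' Ha]] := Dtime h h0 t Ht.
  exists t' => //; rewrite mem_iota add0n /=.
  have := He (size x); rewrite -size_hist -/h => He'.
  by have /INR_lt := Rlt_le_trans _ _ _ Ht' He'; lia.
Qed.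

End Padding.

(** * A machine that certifies the length of its own history *)

(** A finite automaton running along the marks decides which survive; only the number of survivors,
    [tfun], matters, not where in the row the marks lie. *)
Record thinner := Thinner {
  tJ : finType;
  tj0 : tJ;
  tnext : tJ -> tJ;
  tkeep : pred tJ;
  tfun : nat -> nat;
  tfunP : forall n, \sum_(i < n) tkeep (iter i tnext tj0) = tfun n
}.

Fixpoint thin (t : thinner) (j : tJ t) (s : seq bool) : seq bool :=
  match s with
  | [::] => [::]
  | true :: s' => tkeep j :: thin (tnext j) s'
  | false :: s' => false :: thin j s'
  end.

Lemma count_thin t (s : seq bool) :
  count id (thin (tj0 t) s) = tfun t (count id s).
Proof.
rewrite -tfunP; move: (tj0 t) => j; elim: s j => [|[] s IH] j; first by rewrite big_ord0.
  rewrite (_ : count id (true :: s) = (count id s).+1) // big_ord_recl /= IH; congr (_ + _).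
  by apply: eq_bigr => i _; rewrite -iterSr.
by rewrite /= IH.
Qed.

Lemma iter_ordS m i : val (iter i (@ordS m.+1) ord0) = i %% m.+1.
Proof.
elim: i => [|i IH]; first by rewrite mod0n.
by rewrite iterS [LHS]/= IH -addn1 modnDml addn1.
Qed.

Lemma ceil_thinP m n :
  \sum_(i < n) (iter i (@ordS m.+1) ord0 == ord0) = (n + m) %/ m.+1.
Proof.
elim: n => [|n IH]; first by rewrite big_ord0 divn_small.
rewrite big_ord_recr /= IH -val_eqE iter_ordS addSn divnS // -addnS addnC; congr (_ + _).
by rewrite /dvdn modnDr.
Qed.

Lemma floor_thinP m n :
  \sum_(i < n) (iter i (@ordS m.+1) ord0 == ord_max) = n %/ m.+1.
Proof.
elim: n => [|n IH]; first by rewrite big_ord0 divn_small.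
rewrite big_ord_recr /= IH -val_eqE iter_ordS divnS // addnC; congr (nat_of_bool _ + _).
have := ltn_pmod n (ltn0Sn m); rewrite {3}(divn_eq n m.+1) -addnS dvdn_addr ?dvdn_mull //.
move: (n %% m.+1) => k; rewrite ltnS leq_eqVlt => /predU1P[->|lt].
  by rewrite eqxx dvdnn.
by rewrite gtnNdvd ?ltn_eqF.
Qed.

Lemma pred_thinP n : \sum_(i < n) iter i (fun=> true) false = n.-1.
Proof.
case: n => [|n]; first by rewrite big_ord0.
by rewrite big_ord_recl add0n /= (eq_bigr (fun=> 1)) ?sum_nat_const ?card_ord ?muln1 //.
Qed.

(** Keeping the first mark of every block of [m.+1] rounds the quotient up; keeping the last rounds
    it down. *)
Definition ceil_thinner m :=
  @Thinner 'I_m.+1 ord0 (@ordS m.+1) (pred1 ord0) _ (ceil_thinP m).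
Definition floor_thinner m :=
  @Thinner 'I_m.+1 ord0 (@ordS m.+1) (pred1 ord_max) _ (floor_thinP m).
Definition pred_thinner := @Thinner bool false (fun=> true) id predn pred_thinP.

Inductive mode := Widen | Test | Count.

(** Between the two thinner states, [Chk] remembers whether at least one and at least two [markx]
    survive; its last bit tells whether a [markw] does. *)
Inductive gstate (tA tB : thinner) :=
  | Back of mode
  | Wid of bool
  | Chk of tJ tA & bool & bool & tJ tB & bool
  | Cnt of bool
  | Acc.

Arguments Back {tA tB}.
Arguments Wid {tA tB}.
Arguments Chk {tA tB}.
Arguments Cnt {tA tB}.
Arguments Acc {tA tB}.

Section StateFinite.

Variables (tA tB : thinner).

Definition gstate_code (s : gstate tA tB) :
    option (option bool) + bool + (tJ tA * bool * bool * tJ tB * bool) + bool :=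
  match s with
  | Back Widen => inl (inl (inl (Some (Some true))))
  | Back Test => inl (inl (inl (Some (Some false))))
  | Back Count => inl (inl (inl (Some None)))
  | Acc => inl (inl (inl None))
  | Wid b => inl (inl (inr b))
  | Chk i a b j c => inl (inr (i, a, b, j, c))
  | Cnt b => inr b
  end.

Definition gstate_decode
    (c : option (option bool) + bool + (tJ tA * bool * bool * tJ tB * bool) + bool) :
    gstate tA tB :=
  match c with
  | inl (inl (inl (Some (Some true)))) => Back Widen
  | inl (inl (inl (Some (Some false)))) => Back Test
  | inl (inl (inl (Some None))) => Back Count
  | inl (inl (inl None)) => Acc
  | inl (inl (inr b)) => Wid b
  | inl (inr (i, a, b, j, c)) => Chk i a b j c
  | inr b => Cnt b
  end.

Lemma gstate_codeK : cancel gstate_code gstate_decode.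
Proof. by case=> [[]|?|? ? ? ? ?|?|]. Qed.

HB.instance Definition _ := Finite.copy (gstate tA tB) (can_type gstate_codeK).

End StateFinite.

(** The marks are erasable copies of [isx] and [inw] that a test uses up. *)
Record gcell (r : nat) := GCell {
  isx : bool; inw : bool; markx : bool; markw : bool; cnt : 'I_r.+1
}.

Section CellFinite.
Variable r : nat.
Definition gcell_code (c : gcell r) := (isx c, inw c, markx c, markw c, cnt c).
Definition gcell_decode (t : bool * bool * bool * bool * 'I_r.+1) :=
  let: (a, b, c, d, e) := t in GCell a b c d e.
Lemma gcell_codeK : cancel gcell_code gcell_decode.
Proof. by case. Qed.
HB.instance Definition _ := Finite.copy (gcell r) (can_type gcell_codeK).
End CellFinite.

Section Program.

Variables (tA tB : thinner) (r : nat).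
Notation gstate := (gstate tA tB).
Notation gcell := (gcell r).

(* [Wid] lengthens the segment of [inw] cells by one and refreshes the marks;
   [Chk] thins both sets of marks, until few [markx] or no [markw] are left; [Cnt]
   increments the base [r.+1] counter on the [inw] cells. *)
Definition prog_mu (s : gstate) (c : gcell) : gstate * gcell :=
  let: GCell x w fx fw k := c in
  match s with
  | Wid found => (Wid (found || ~~ w), GCell x (w || ~~ found) x (w || ~~ found) k)
  | Chk i a b j sw =>
    let kx := fx && tkeep i in
    let kw := fw && tkeep j in
    (Chk (if fx then tnext i else i) (a || kx) (b || (a && kx))
         (if fw then tnext j else j) (sw || kw),
     GCell x w kx kw k)
  | Cnt c => if w then (Cnt (c && (k == ord_max)), GCell x w fx fw (inc_digit c k))
             else (Cnt c, GCell x w fx fw k)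
  | _ => (s, GCell x w fx fw k)
  end.

Definition start_of (m : mode) : gstate :=
  match m with
  | Widen => Wid false
  | Test => Chk (tj0 tA) false false (tj0 tB) false
  | Count => Cnt true
  end.

Definition prog_turn (s : gstate) : gstate * option gcell :=
  match s with
  | Back m => (start_of m, None)
  | Wid found =>
    (Back Test, if found then None else Some (GCell false true false true ord0))
  | Chk _ _ b _ sw =>
    (Back (if sw then (if b then Test else Count) else Widen), None)
  | Cnt c => (if c then Acc else Back Count, None)
  | Acc => (Acc, None)
  end.

Definition prog : BM := Build_BM prog_mu prog_turn.

Definition prog_cell0 : gcell := GCell true false false false ord0.

Definition prog_gm : GM :=
  @Build_GM prog prog_cell0 prog_cell0 (Back Widen) (fun s => s == Acc).

Notation step := (@bstep prog).

Definition xs (v : seq gcell) := map (@isx r) v.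
Definition ws (v : seq gcell) := map (@inw r) v.
Definition fxs (v : seq gcell) := map (@markx r) v.
Definition fws (v : seq gcell) := map (@markw r) v.
Definition cnts (v : seq gcell) : seq 'I_r.+1 := [seq cnt c | c <- v & inw c].

Lemma pass_back (s : gstate) v : (s = Acc \/ exists m, s = Back m) ->
  pass (B := prog) s v = (s, v).
Proof. by case=> [->|[m ->]]; elim: v => //= -[x w fx fw k] v ->. Qed.

Lemma round m v :
  iter 2 step (Back m, v) =
  ((bturn (pass (B := prog) (start_of m) v).1).1,
   (pass (B := prog) (start_of m) v).2 ++
     seq_of_opt (bturn (pass (B := prog) (start_of m) v).1).2).
Proof.
have pb u : pass (B := prog) (Back m) u = (Back m, u).
  by apply: pass_back; right; exists m.
by rewrite -[iter 2 _ _]/(step (step _)) {2}/bstep /= pb /= cats0 /bstep /= revK.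
Qed.

Lemma wid_pass found v :
  let p := pass (B := prog) (Wid found) v in
  [/\ p.1 = Wid (found || has negb (ws v)), xs p.2 = xs v,
      count id (ws p.2) = count id (ws v) + (~~ found && has negb (ws v)),
      fxs p.2 = xs v & fws p.2 = ws p.2] /\
  (all (fun c => cnt c == ord0) v -> all (fun c => cnt c == ord0) p.2).
Proof.
elim: v found => [|[x w fx fw k] v IH] found /=.
  by rewrite orbF andbF addn0.
have [[H1 H2 H3 H4 H5] H6] := IH (found || ~~ w); split.
  split; rewrite ?H1 ?H2 ?H3 ?H4 ?H5 ?orbA //=.
  by case: found {IH H1 H2 H3 H4 H5 H6}; case: w; rewrite /= ?addn0 ?add0n; lia.
by move=> /andP[-> /H6].
Qed.

Lemma chk_pass i a b j sw v :
  let p := pass (B := prog) (Chk i a b j sw) v in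
  let n := count id (thin i (fxs v)) in
  [/\ exists i' j', p.1 = Chk i' (a || (0 < n)) (b || (1 < n) || (a && (0 < n))) j'
                       (sw || (0 < count id (thin j (fws v)))),
      xs p.2 = xs v, ws p.2 = ws v,
      fxs p.2 = thin i (fxs v) & fws p.2 = thin j (fws v)] /\
  (all (fun c => cnt c == ord0) v -> all (fun c => cnt c == ord0) p.2).
Proof.
elim: v i a b j sw => [|[x w fx fw k] v IH] i a b j sw /=.
  by split=> //; split=> //; exists i, j; rewrite andbF !orbF.
have [[[i' [j' H1]] H2 H3 H4 H5] H6] := IH (if fx then tnext i else i)
  (a || fx && tkeep i) (b || a && (fx && tkeep i))
  (if fw then tnext j else j) (sw || fw && tkeep j); split; last first.
  by move=> /andP[-> /H6].
split; [|by rewrite /= H2|by rewrite /= H3|by rewrite /= H4; case: (fx)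
  |by rewrite /= H5; case: (fw)].

exists i', j'; rewrite H1 {IH H1 H2 H3 H4 H5 H6}.
have -> : count id (match fx with true => tkeep i :: thin (tnext i) (fxs v) | false => false :: thin i (fxs v) end)
  = (fx && tkeep i) + count id (thin (if fx then tnext i else i) (fxs v)) by case: fx.
have -> : count id (match fw with true => tkeep j :: thin (tnext j) (fws v) | false => false :: thin j (fws v) end)
  = (fw && tkeep j) + count id (thin (if fw then tnext j else j) (fws v)) by case: fw.
move: (count id (thin _ (fxs v))) (count id (thin _ (fws v))) => n1 n2.
congr (Chk _ _ _ _ _).
- by case: a; case: (fx && _).
- by case: a; case: b; case: (fx && _); case: n1 => [|[|n1]].
- by case: sw; case: (fw && _).
Qed.

Lemma cnts_cons c v : cnts (c :: v) = if inw c then cnt c :: cnts v else cnts v.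
Proof. by rewrite /cnts /=; case: (inw c). Qed.

Lemma cnt_pass c v :
  let p := pass (B := prog) (Cnt c) v in
  [/\ p.1 = Cnt (inc c (cnts v)).1, ws p.2 = ws v, xs p.2 = xs v
    & cnts p.2 = (inc c (cnts v)).2].
Proof.
elim: v c => [|[x w fx fw k] v IH] c //=.
case: w; [have [H1 H2 H3 H4] := IH (c && (k == ord_max)) | have [H1 H2 H3 H4] := IH c].
  by rewrite /= !cnts_cons H1 H2 H3 /= H4.
by rewrite /= !cnts_cons H1 H2 H3 H4.
Qed.

Hypothesis tB_lt : forall b, 0 < b -> tfun tB b < b.

Record row_inv n w (v : seq gcell) : Prop := RowInv {
  inv_xs : count id (xs v) = n.+1;
  inv_ws : count id (ws v) = w;
  inv_size : size v = maxn n.+1 w;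
  inv_cnt : all (fun c => cnt c == ord0) v
}.

Lemma size_passP (s : gstate) v : size (pass (B := prog) s v).2 = size v.
Proof. exact: size_pass. Qed.

Lemma wid_round n w v : row_inv n w v ->
  exists v', [/\ iter 2 step (Back Widen, v) = (Back Test, v'),
    row_inv n w.+1 v', count id (fxs v') = n.+1 & count id (fws v') = w.+1].
Proof.
move=> [Hx Hw Hs Hc]; rewrite round.
have [[H1 H2 H3 H4 H5] H6] := wid_pass false v.
have hasE : has negb (ws v) = (w < size v).
  rewrite -Hw has_count -(size_map (@inw r) v) -/(ws v) -(count_predC id (ws v)).
  by rewrite -[X in X < _ + _]addn0 ltn_add2l.
have HsP := size_passP (Wid false) v.
rewrite [start_of _]/= H1 /=; rewrite hasE in H1 H3 *.
move: (pass _ _).2 H2 H3 H4 H5 H6 HsP => u H2 H3 H4 H5 H6 HsP.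
have {}H6 := H6 Hc.
case: ltnP H3 => lt /= H3.
  exists u; split; rewrite ?cats0 // ?H4 ?H5 ?Hx //; last by rewrite H3 Hw addn1.
  split=> //; rewrite ?H2 ?Hx // ?H3 ?Hw ?addn1 // HsP Hs.
  by rewrite Hs in lt; lia.
exists (u ++ [:: GCell false true false true ord0]); split=> //.
- split; rewrite ?/xs ?/ws ?map_cat ?count_cat /= -?/(xs _) -?/(ws _).
  + by rewrite H2 Hx; lia.
  + by rewrite H3 Hw; lia.
  + by rewrite size_cat HsP /= Hs; rewrite Hs in lt; lia.
  + by rewrite all_cat H6.
- by rewrite /fxs map_cat count_cat /= -/(fxs _) H4 Hx; lia.
- by rewrite /fws map_cat count_cat /= -/(fws _) H5 H3 Hw; lia.
Qed.

Lemma chk_round n w v : row_inv n w v ->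
  let a := tfun tA (count id (fxs v)) in
  let b := tfun tB (count id (fws v)) in
  exists v', [/\ iter 2 step (Back Test, v) =
      (Back (if b == 0 then Widen else if a <= 1 then Count else Test), v'),
    row_inv n w v', count id (fxs v') = a & count id (fws v') = b].
Proof.
move=> [Hx Hw Hs Hc] a b; rewrite round.
have [[[i' [j' H1]] H2 H3 H4 H5] H6] := chk_pass (tj0 tA) false false (tj0 tB) false v.
have HsP := size_passP (Chk (tj0 tA) false false (tj0 tB) false) v.
rewrite [start_of _]/= H1 /= !count_thin -/a -/b orbF cats0.
exists (pass (B := prog) (Chk (tj0 tA) false false (tj0 tB) false) v).2.
split; rewrite ?H4 ?H5 ?count_thin //.
  by congr (Back _, _); rewrite lt0n [a <= 1]leqNgt; case: (b == 0); case: (1 < a).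
by split; rewrite ?H2 ?H3 // ?HsP //; apply: H6.
Qed.

(** The marks of the width have to outlive the thinning of the input, so their exhaustion is tested
    first in each round. *)
Fixpoint chkb fuel a b : bool :=
  if fuel is f.+1 then
    if tfun tB b == 0 then false else
    if tfun tA a <= 1 then true else chkb f (tfun tA a) (tfun tB b)
  else false.

Lemma chk_phase n w fuel v :
  row_inv n w v -> 0 < count id (fws v) <= fuel ->
  exists k v', [/\ k <= fuel, row_inv n w v' &
    iter (2 * k) step (Back Test, v) =
    (Back (if chkb fuel (count id (fxs v)) (count id (fws v)) then Count else Widen), v')].
Proof.
elim: fuel v => [|f IH] v inv /andP[b0 bf]; first by lia.
have [v' [E inv' Ha Hb]] := chk_round inv.
rewrite [chkb _ _ _]/=; case: ifP E => [b0'|/negbT b0'].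
  by move=> E; exists 1, v'.
case: ifP => [a1|a1] E; first by exists 1, v'.
have [|k [v2 [Hk inv2 E2]]] := IH v' inv'.
  by rewrite Hb lt0n b0' /= -ltnS; apply: leq_trans (tB_lt b0) bf.
exists k.+1, v2; split=> //.
by rewrite mulnS addnC iterD E E2 Ha Hb.
Qed.

(** By [tB_lt] each round removes one of the [w] marks or more, so this fuel suffices. The successor
    counts the end cell of the first row. *)
Definition relb n w := chkb w n.+1 w.

(** Each width costs one round trip for widening and at most as many tests as the width itself. *)
Lemma search_phase n w d v w0 : w0 + d.+1 = w ->
  relb n w -> (forall w', 0 < w' < w -> ~~ relb n w') -> row_inv n w0 v ->
  exists k v', [/\ k <= d.+1 * w.+1, row_inv n w v' &
    iter (2 * k) step (Back Widen, v) = (Back Count, v')].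
Proof.
elim: d w0 v => [|d IH] w0 v wE rw rmin inv.
  have [v1 [E1 inv1 Hx1 Hw1]] := wid_round inv.
  have [|k [v2 [Hk inv2 E2]]] := chk_phase (fuel := w0.+1) inv1; first by rewrite Hw1 ltn0Sn leqnn.
  rewrite addn1 in wE; rewrite Hx1 Hw1 -/(relb n w0.+1) wE rw in E2 Hk inv2.
  exists (k + 1), v2; split=> //; first by lia.
  by rewrite mulnDr iterD E1 E2.
have [v1 [E1 inv1 Hx1 Hw1]] := wid_round inv.
have [|k [v2 [Hk inv2 E2]]] := chk_phase (fuel := w0.+1) inv1; first by rewrite Hw1 ltn0Sn leqnn.
rewrite Hx1 Hw1 -/(relb n w0.+1) (negbTE (rmin _ _)) in E2; last by lia.
have [|k3 [v3 [Hk3 inv3 E3]]] := IH w0.+1 v2 _ rw rmin inv2; first by lia.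
exists (k3 + (k + 1)), v3; split=> //.
  by rewrite mulSn; lia.
rewrite (_ : 2 * (k3 + (k + 1)) = 2 * k3 + (2 * k + 2)); last lia.
by rewrite (iterD (2 * k3)) (iterD (2 * k)) E1 E2 E3.
Qed.

Lemma size_cnts v : size (cnts v) = count id (ws v).
Proof. by rewrite size_map size_filter /ws count_map. Qed.

(** The state one sweep before the end is recorded because [Acc] is absorbing: a different state
    there excludes all earlier acceptance. *)
Lemma count_phase k : forall v t, t + k.+1 = r.+1 ^ count id (ws v) ->
  digits_val (cnts v) = t ->
  exists v' u, [/\ iter (2 * k).+1 step (Back Count, v) = (Cnt true, u),
    iter (2 * k.+1) step (Back Count, v) = (Acc, v'),
    count id (ws v') = count id (ws v) & size v' = size v].
Proof.
elim: k => [|k IH] v t Ht Hv.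
all: have [H1 H2 H3 H4] := cnt_pass true v.
all: have HsP := size_passP (Cnt true) v.
all: have := inc_val true (cnts v); rewrite size_cnts -Ht Hv => Hinc.
all: have := digits_val_lt (inc true (cnts v)).2; rewrite size_inc size_cnts -Ht => Hlt.
- have c1 : (inc true (cnts v)).1 by case: (inc _ _).1 Hinc => // Hinc; lia.
  exists (pass (B := prog) (Cnt true) v).2, (rev v); split; rewrite ?HsP ?H2 //.
  + by rewrite -[iter _ _ _]/(step _) /bstep /= pass_back //=; [rewrite cats0 | right; exists Count].
  + by rewrite muln1 round H1 /= c1 cats0.
have c0 : (inc true (cnts v)).1 = false by case: (inc _ _).1 Hinc => // Hinc; lia.
have E : iter 2 step (Back Count, v) = (Back Count, (pass (B := prog) (Cnt true) v).2).
  by rewrite round H1 /= c0 cats0.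
have [||v' [u [E1 E2 E3 E4]]] := IH (pass (B := prog) (Cnt true) v).2 t.+1.
- by rewrite H2 -Ht addSnnS.
- by rewrite H4; rewrite c0 in Hinc; lia.
exists v', u; rewrite E3 E4 H2 HsP; split=> //.
  by rewrite mulnS -addnS addnC iterD E.
by rewrite mulnS addnC iterD E.
Qed.

(** The lower bound on [t] makes every accepted history long; the upper bound and the final row size
    keep the padded word short enough to be written. *)
Lemma program_run n w : 0 < w -> relb n w -> (forall w', 0 < w' < w -> ~~ relb n w') ->
  exists t, [/\ 0 < t,
    2 * r.+1 ^ w <= t <= 2 * (w * w.+1 + r.+1 ^ w),
    (forall s, s < t -> (gconf prog_gm n s).1 != Acc) &
    forall s, t <= s -> [/\ (gconf prog_gm n s).1 = Acc,
      count (@inw r) (gconf prog_gm n s).2 = w & size (gconf prog_gm n s).2 = maxn n.+1 w]].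
Proof.
move=> w0 rw rmin.
set v0 := rcons (nseq n prog_cell0) prog_cell0.
have inv0 : row_inv n 0 v0.
  have v0E : v0 = nseq n.+1 prog_cell0 by rewrite /v0; elim: (n) => //= m ->.
  rewrite v0E; split.
  - by rewrite /xs map_nseq count_nseq mul1n.
  - by rewrite /ws map_nseq count_nseq.
  - by rewrite size_nseq maxn0.
  - by rewrite all_nseq eqxx orbT.
have [|k1 [v1 [Hk1 inv1 E1]]] := @search_phase n w w.-1 v0 0 _ rw rmin inv0.
  by rewrite add0n prednK.
rewrite prednK // in Hk1.
have v1cnt : digits_val (cnts v1) = 0.
  have [_ _ _] := inv1; elim: (v1) => //= c v IH /andP[/eqP c0 /IH].
  by rewrite cnts_cons; case: ifP => //= _ ->; rewrite c0 muln0.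
have R0 : 0 < r.+1 ^ w by rewrite expn_gt0.
have [|v2 [u [E2 E3 H2 Hs2]]] := @count_phase (r.+1 ^ w).-1 v1 0 _ v1cnt.
  by rewrite (inv_ws inv1) add0n prednK.
rewrite prednK // in E3.
have gE s : gconf prog_gm n s = iter s step (Back Widen, v0) by [].
have Eacc : gconf prog_gm n (2 * k1 + 2 * r.+1 ^ w) = (Acc, v2).
  by rewrite gE addnC iterD E1 E3.
have Epre : (gconf prog_gm n (2 * k1 + 2 * r.+1 ^ w).-1).1 = Cnt true.
  rewrite (_ : _.-1 = (2 * (r.+1 ^ w).-1).+1 + 2 * k1); last by lia.
  by rewrite gE iterD E1 E2.
have accS s : (gconf prog_gm n s).1 = Acc ->
   gconf prog_gm n s.+1 = (Acc, rev (gconf prog_gm n s).2).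
  move=> H; rewrite [gconf _ _ s.+1]/(step (gconf prog_gm n s)) /bstep H.
  by rewrite pass_back /= ?cats0 //; left.
have accD s j : (gconf prog_gm n s).1 = Acc -> (gconf prog_gm n (s + j)).1 = Acc.
  by move=> H; elim: j => [|j IH]; rewrite ?addn0 // addnS accS.
exists (2 * k1 + 2 * r.+1 ^ w); split.
- by lia.
- by lia.
- move=> s lt; apply/eqP => Hs.
  have := accD s ((2 * k1 + 2 * r.+1 ^ w).-1 - s) Hs.
  by rewrite subnKC ?Epre //; lia.
move=> s /subnKC <-; elim: (s - _) => [|j [IH1 IH2 IH3]].
  rewrite addn0 Eacc; split=> //=.
    by rewrite -(inv_ws inv1) -H2 /ws count_map.
  by rewrite Hs2 (inv_size inv1).
by rewrite addnS accS //= count_rev size_rev IH2 IH3.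
Qed.

End Program.

Lemma chkb_sound tA tB fuel a b : chkb tA tB fuel a b ->
  exists s, [/\ 0 < s, iter s (tfun tA) a <= 1 & 0 < iter s (tfun tB) b].
Proof.
elim: fuel a b => //= f IH a b; case: eqP => // b0.
case: ifP => [a1 _|_ /IH [s [s0 Ha Hb]]].
  by exists 1; split=> //=; lia.
by exists s.+1; rewrite !iterSr.
Qed.

Lemma chkb_complete tA tB fuel a b s :
  (forall b, 0 < b -> tfun tB b < b) -> tfun tB 0 = 0 ->
  b <= fuel -> 0 < s -> iter s (tfun tA) a <= 1 -> 0 < iter s (tfun tB) b ->
  chkb tA tB fuel a b.
Proof.
move=> tB_lt tB0.
have it0 j : iter j (tfun tB) 0 = 0 by elim: j => //= j ->.
elim: fuel a b s => [|f IH] a b [|s] // bf _; rewrite !iterSr => Ha Hb.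
  by move: Hb; rewrite (_ : b = 0) ?tB0 ?it0 //; lia.
rewrite /=; case: eqP => [b0|b0]; first by move: Hb; rewrite b0 it0.
case: leqP => // a1; case: s Ha Hb => [|s] Ha Hb; first by move: Ha; rewrite /= leqNgt a1.
apply: (IH _ _ s.+1) => //.
have : 0 < b by case: (b) b0 => //; rewrite tB0.
by move/tB_lt; lia.
Qed.

Lemma iter_ceil m s a : (iter s (fun n => (n + m) %/ m.+1) a <= 1) = (a <= m.+1 ^ s).
Proof.
elim: s a => [|s IH] a; first by rewrite expn0.
by rewrite iterSr IH expnSr -ltnS ltn_divLR // mulSn; lia.
Qed.

Lemma iter_floor m s a : (0 < iter s (divn^~ m.+1) a) = (m.+1 ^ s <= a).
Proof.
elim: s a => [|s IH] a; first by rewrite expn0.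
by rewrite iterSr IH expnSr leq_divRL.
Qed.

Lemma iter_pred s a : iter s predn a = a - s.
Proof. by elim: s => [|s IH]; rewrite ?subn0 // iterS IH subnS. Qed.

(** * The padding argument for an arbitrary width function *)

Section Core.

Variables (tA tB : thinner) (rho : nat).
Hypothesis tB_lt : forall b, 0 < b -> tfun tB b < b.
Variable wf : nat -> nat.
Hypothesis wf_gt0 : forall n, 0 < wf n.
Hypothesis wf_rel : forall n, relb tA tB n (wf n).
Hypothesis wf_min : forall n w, 0 < w < wf n -> ~~ relb tA tB n w.
Variable q : nat.
Hypothesis wf_exp : forall n, n < 2 ^ (q * wf n).

Variables (M : PTM) (NM : nat -> nat) (T : nat -> R) (L : seq bool -> Prop).
Variables (k : error_kind) (d : R).
Hypothesis haltsM : thalts_within M NM.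
Hypothesis yesL : forall x, L x -> 2 ^ NM (size x) <= 2 * tacc_count M x (NM (size x)).
Hypothesis noL : forall x, ~ L x -> tacc_count M x (NM (size x)) = 0.
Hypothesis bounds : forall n N, 2 ^ (rho * wf n) <= N ->
  NM n < N /\ (INR (maxn (maxn n.+1 (wf n)) (NM n).*2).+1 < T N)%Re.
Hypothesis conv : convertible k T d.

Theorem core : exists (kappa : nat) (M' : PTM),
  [/\ deterministic M', thalts_within M' (fun n => 2 ^ (kappa * wf n))
    & forall x, L x <->
      cstate (trun M' x (fun _ => false) (2 ^ (kappa * wf (size x)))) = tqacc M'].
Proof.
pose r := (2 ^ rho).-1.
have rE : r.+1 = 2 ^ rho by rewrite prednK // expn_gt0.
pose G := prog_gm tA tB r.
have run n := program_run r tB_lt (wf_gt0 n) (wf_rel n) (@wf_min n).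
have ex n : exists t, (gconf G n t).1 == Acc.
  have [t [_ _ _ H]] := run n; exists t.
  by have [-> _ _] := H t (leqnn t).
pose ts n := ex_minn (ex n).
have tsE n : [/\ 0 < ts n,
    2 * 2 ^ (rho * wf n) <= ts n <= 2 * (wf n * (wf n).+1 + 2 ^ (rho * wf n)),
    (forall s, s < ts n -> (gconf G n s).1 != Acc) &
    forall s, ts n <= s -> [/\ (gconf G n s).1 = Acc,
      count (@inw r) (gconf G n s).2 = wf n & size (gconf G n s).2 = maxn n.+1 (wf n)]].
  have [t [t0 Ht Hlt Hge]] := run n.
  suff -> : ts n = t by split; rewrite // -?rE ?expnM -?rE.
  rewrite /ts; case: ex_minnP => m Hm Hmin.
  have [Ht2 _ _] := Hge t (leqnn t).
  apply/eqP; rewrite eqn_leq Hmin ?Ht2 ?eqxx //= leqNgt.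
  by apply/negP => /Hlt; rewrite Hm.
have wE n : width (G := G) (@inw r) ts n = wf n.
  by rewrite /width; have [_ _ _ /(_ _ (leqnn _)) []] := tsE n.
have szle n s : size (gconf G n s).2 <= maxn n.+1 (wf n).
  have [_ _ _ H] := tsE n.
  have [_ _ <-] := H (maxn s (ts n)) (leq_maxr _ _).
  by apply: size_gconf_mono; rewrite leq_maxl.
have hist_ge n s : s < hist_size G n s.
  rewrite /hist_size; have : \sum_(i < s.+1) 1 <= \sum_(i < s.+1) size (gconf G n i).2.
    by apply: leq_sum => i _; have := size_gconf G n i; lia.
  by rewrite sum1_card card_ord.
(* With [a], [b], [c] for [2^(rho w)], [2^(q w)], [2^w], there are at most [a c^5] rows of size at
   most [b c]. *)
have hist_le n : hist_size G n (ts n) <= 2 ^ ((rho + q + 6) * wf n).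
  have H1 : hist_size G n (ts n) <= (ts n).+1 * maxn n.+1 (wf n).
    rewrite /hist_size; apply: leq_trans (_ : \sum_(i < (ts n).+1) maxn n.+1 (wf n) <= _).
      by apply: leq_sum => i _; apply: szle.
    by rewrite sum_nat_const card_ord.
  apply: leq_trans H1 _; have [_ /andP[_ Ht] _ _] := tsE n.
  have w0 := wf_gt0 n; have wn := wf_exp n.
  have ww : wf n < 2 ^ wf n by rewrite ltn_expl.
  have -> : (rho + q + 6) * wf n = rho * wf n + q * wf n + wf n + wf n + wf n + wf n + wf n + wf n by lia.
  have a0 : 0 < 2 ^ (rho * wf n) by rewrite expn_gt0.
  rewrite !expnD; move: (wf n) (ts n) (2 ^ (rho * wf n)) (2 ^ (q * wf n)) (2 ^ wf n) a0 Ht w0 wn ww.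
  move=> w t a b c a0 Ht w0 wn ww.
  have H2 : maxn n.+1 w <= b * c.
    rewrite geq_max; apply/andP; split.
      apply: leq_trans wn _.  rewrite leq_pmulr //; lia.
    by apply: leq_trans (ltnW ww) _; rewrite leq_pmull //; lia.
  have H3 : t.+1 <= a * c * c * c * c * c.
    have c2 : 2 <= c by lia.
    have H4 : w * w.+1 <= c * c by nia.
    have H5 : t.+1 <= 5 * (a * (c * c)) by nia.
    have H6 : 8 <= c * c * c by nia.
    have H7 := leq_mul H6 (leqnn (a * (c * c))).
    nia.
  by apply: leq_trans (leq_mul H3 H2) _; apply: eq_leq; lia.
have := @padding G (@inw r) ts.
have -> : width (G := G) (@inw r) ts = wf by apply: functional_extensionality.
move=> P; apply: (P _ _ _ (rho + q + 6) _ _ M NM T L k d) => //.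
- by move=> n; have [] := tsE n.
- by move=> n; have [_ _ _ /(_ _ (leqnn _)) [/= ->]] := tsE n.
- by move=> n i /andP[_ Hi]; have [_ _ /(_ _ Hi)] := tsE n.
(* Acceptance occurs only from [ts n] on, and a history with [s] sweeps has more than [s] letters,
   so its length exceeds [2^(rho w)]. *)
- move=> n s Gs; have [t0 /andP[Ht _] Hlt Hge] := tsE n.
  have ts_s : ts n <= s by rewrite leqNgt; apply/negP => /Hlt; rewrite (eqP Gs).
  have [_ _ ->] := Hge s ts_s.
  by apply: bounds; have := hist_ge n s; lia.
Qed.

End Core.

(** * Widths of order [n^(p/q)] and [log n] *)

Lemma rel_floor p q n w : 0 < p ->
  relb (ceil_thinner (2 ^ q).-1) (floor_thinner (2 ^ p).-1) n w <->
  exists s, [/\ 0 < s, n < 2 ^ (q * s) & 2 ^ (p * s) <= w].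
Proof.
move=> p0.
have E j : (2 ^ j).-1.+1 = 2 ^ j by rewrite prednK // expn_gt0.
split.
  move/chkb_sound => [s [s0 Ha Hb]]; exists s; rewrite s0 /= in Ha Hb *.
  by move: Ha Hb; rewrite iter_ceil iter_floor !E -!expnM.
move=> [s [s0 Ha Hb]]; apply: (@chkb_complete _ _ _ _ _ s) => //=.
- move=> b b0; rewrite ltn_Pdiv // E.
  by rewrite -{1}(expn0 2) ltn_exp2l.
- by rewrite iter_ceil E -expnM.
- by rewrite iter_floor E -expnM.
Qed.

Lemma rel_pred n w :
  relb (ceil_thinner 1) pred_thinner n w <-> exists s, [/\ 0 < s, n < 2 ^ s & s < w].
Proof.
split.
  move/chkb_sound => [s [s0 Ha Hb]]; exists s; rewrite s0 /= in Ha Hb *.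
  by move: Ha Hb; rewrite iter_ceil iter_pred subn_gt0.
move=> [s [s0 Ha Hb]]; apply: (@chkb_complete _ _ _ _ _ s) => //=.
- by case.
- by rewrite iter_ceil.
- by rewrite iter_pred subn_gt0.
Qed.

Lemma least_width tA tB :
  (forall n, exists w, (0 < w) && relb tA tB n w) ->
  exists wf, [/\ forall n, 0 < wf n, forall n, relb tA tB n (wf n)
    & forall n w, 0 < w < wf n -> ~~ relb tA tB n w].
Proof.
move=> ex; exists (fun n => ex_minn (ex n)); split=> n.
- by case: ex_minnP => m /andP[].
- by case: ex_minnP => m /andP[].
- move=> w; case: ex_minnP => m _ Hmin /andP[w0 wm].
  by apply/negP => Hr; have := Hmin w; rewrite w0 Hr => /(_ isT); lia.
Qed.

Lemma least_exponent q n : 0 < q -> exists s,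
  [/\ 0 < s, n < 2 ^ (q * s) & 2 ^ (q * s) <= 2 ^ q * n.+1].
Proof.
move=> q0.
have ex : exists s, (0 < s) && (n < 2 ^ (q * s)).
  exists n.+1; rewrite /=; apply: leq_trans (ltnW (ltn_expl n.+1 (ltnSn 1))) _.
  by rewrite leq_exp2l // leq_pmull.
case: (ex_minnP ex) => s /andP[s0 Hs] Hmin; exists s; split=> //.
case: s s0 Hs Hmin => [|[|s]] // _ Hs Hmin; first by rewrite muln1 leq_pmulr.
rewrite mulnS expnD leq_pmul2l ?expn_gt0 // ltnW // ltnS leqNgt.
by apply/negP => H; have := Hmin s.+1; rewrite H => /(_ isT); rewrite ltnn.
Qed.

(** The least width is [2^(p s)] for the least [s > 0] with [n < 2^(q s)], and such an [s]
    overshoots by at most a factor [2^q]. Integer powers of both sides avoid real exponents. *)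
Lemma width_floor p q : 0 < p -> 0 < q ->
  let tA := ceil_thinner (2 ^ q).-1 in
  let tB := floor_thinner (2 ^ p).-1 in
  exists wf, [/\ forall n, 0 < wf n, forall n, relb tA tB n (wf n),
    forall n w, 0 < w < wf n -> ~~ relb tA tB n w
    & forall n, [/\ n.+1 ^ p <= wf n ^ q, wf n ^ q <= 2 ^ (p * q) * n.+1 ^ p
               & n < 2 ^ (q * wf n)]].
Proof.
move=> p0 q0 tA tB.
have [|wf [w0 wr wmin]] := @least_width tA tB.
  move=> n; have [s [s0 Hs _]] := least_exponent n q0.
  exists (2 ^ (p * s)); rewrite expn_gt0 /=; apply/rel_floor => //.
  by exists s.
exists wf; split=> // n; have /(rel_floor _ _ _ p0) [s [s0 Hn Hw]] := wr n; split.
- apply: leq_trans (_ : (2 ^ (q * s)) ^ p <= _); first by rewrite leq_exp2r.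
  by rewrite -expnM [q * s]mulnC [s * q * p]mulnC mulnA expnM leq_exp2r.
- have [s1 [s10 H1 H2]] := least_exponent n q0.
  have Hle : wf n <= 2 ^ (p * s1).
    rewrite leqNgt; apply/negP => H; have := wmin n (2 ^ (p * s1)).
    rewrite expn_gt0 H => /(_ isT) /negP; apply.
    by apply/rel_floor => //; exists s1.
  apply: leq_trans (_ : (2 ^ (p * s1)) ^ q <= _); first by rewrite leq_exp2r.
  have -> : (2 ^ (p * s1)) ^ q = (2 ^ (q * s1)) ^ p by rewrite -!expnM; congr (2 ^ _); lia.
  apply: leq_trans (_ : (2 ^ q * n.+1) ^ p <= _); first by rewrite leq_exp2r.
  by rewrite expnMn -expnM [q * p]mulnC.
- apply: leq_trans Hn _; rewrite leq_exp2l // leq_mul2l; apply/orP; right.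
  apply: leq_trans _ Hw; apply: leq_trans (ltnW (ltn_expl s (ltnSn 1))) _.
  by rewrite leq_exp2l // leq_pmull.
Qed.

Lemma width_pred :
  let tA := ceil_thinner 1 in
  exists wf, [/\ forall n, 0 < wf n, forall n, relb tA pred_thinner n (wf n),
    forall n w, 0 < w < wf n -> ~~ relb tA pred_thinner n w
    & forall n, n < 2 ^ wf n /\ 2 ^ wf n <= 4 * n.+1].
Proof.
move=> tA.
have [|wf [w0 wr wmin]] := @least_width tA pred_thinner.
  move=> n; have [s [s0 Hs _]] := least_exponent n (ltnSn 0).
  by exists s.+1; rewrite /=; apply/rel_pred; exists s; rewrite mul1n in Hs.
exists wf; split=> // n; have /rel_pred [s [s0 Hn Hw]] := wr n; split.
  by apply: leq_trans Hn _; rewrite leq_exp2l // ltnW.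
have [s1 [s10 H1 H2]] := least_exponent n (ltnSn 0); rewrite mul1n in H1 H2.
have Hle : wf n <= s1.+1.
  rewrite leqNgt; apply/negP => H; have := wmin n s1.+1.
  by rewrite /= H => /(_ isT) /negP; apply; apply/rel_pred; exists s1.
apply: leq_trans (_ : 2 ^ s1.+1 <= _); first by rewrite leq_exp2l.
by rewrite expnS; lia.
Qed.

(** * The three cases *)

Lemma trun_deterministic M x cs cs' n : deterministic M ->
  trun M x cs n = trun M x cs' n.
Proof.
move=> Hd; elim: n => //= n ->; rewrite /tstep.
by case: (cs n); case: (cs' n); rewrite ?Hd.
Qed.

(** A deterministic machine accepts on all coin sequences or on none. *)
Lemma in_P_in_RP L : in_P L -> in_RP L.
Proof.
move=> [a [M [K [N [Hd [HK [Hh HL]]]]]]]; exists a, M, K, N; split=> //; split=> // x.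
have cnt : tacc_count M x (N (size x)) =
    if cstate (trun M x (fun _ => false) (N (size x))) == tqacc M then 2 ^ N (size x) else 0.
  rewrite /tacc_count; case: ifP => E.
    rewrite -[RHS](_ : #|{ffun 'I_(N (size x)) -> bool}| = _).
      by apply: eq_card => f; rewrite !inE (trun_deterministic _ _ (fun=> false)) ?E.
    by rewrite card_ffun card_bool card_ord.
  by apply: eq_card0 => f; rewrite inE (trun_deterministic _ _ (fun=> false)) ?E.
rewrite cnt; split=> [/HL ->|HnL]; first by rewrite eqxx leq_pmull.
by case: eqP => // /HL.
Qed.

Lemma INR_muln m n : INR (m * n) = (INR m * INR n)%Re.
Proof. exact: mult_INR. Qed.

Lemma INR_addn m n : INR (m + n) = (INR m + INR n)%Re.
Proof. exact: plus_INR. Qed.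

Lemma INR_pow2 n : INR (2 ^ n) = Rpower 2 (INR n).
Proof. by rewrite INR_expn Rpower_pow //=; lra. Qed.

Lemma INR_ge1 n : 0 < n -> (1 <= INR n)%Re.
Proof. exact: (@INR_leq 1). Qed.

(* [ln 0 = 0] in Rocq, hence [Rpower 0 e = 1]. *)
Lemma npow0 e : npow e 0 = 1%Re.
Proof.
rewrite /npow /Rpower /= /ln; case: Rlt_dec => [H|_]; first by case: (Rlt_irrefl _ H).
by rewrite Rmult_0_r exp_0.
Qed.

Lemma npow_mono e e' n : (e <= e')%Re -> (npow e n <= npow e' n)%Re.
Proof.
case: n => [|n] H; first by rewrite !npow0; lra.
by apply: Rle_Rpower => //; exact: INR_ge1.
Qed.

Lemma log2_ge n w : 2 ^ w <= n -> (INR w <= log2 n)%Re.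
Proof.
move=> H; rewrite /log2.
have ln2 : (0 < ln 2)%Re by have := ln_lt_2; lra.
have Hn : (0 < INR (2 ^ w))%Re by apply: (INR_ltn (m := 0)); rewrite expn_gt0.
have : (ln (INR (2 ^ w)) <= ln (INR n))%Re.
  case: (INR_leq H) => [lt|->]; last by right.
  by left; apply: ln_increasing.
rewrite INR_pow2 /Rpower ln_exp => Hl.
by apply: (Rmult_le_reg_r (ln 2)) => //; rewrite /Rdiv Rmult_assoc Rinv_l; lra.
Qed.

Lemma scale_bound (K : R) : exists j, forall f y z : R,
  (0 <= f <= y)%Re -> (1 <= y)%Re -> (z <= K * f + K)%Re -> (z <= INR (2 ^ j) * y)%Re.
Proof.
have [j Hj] := expn2_above (2 * Rabs K); exists j => f y z [f0 fy] y1 Hz.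
have H1 := Rle_abs K; have H2 := Rabs_pos K.
apply: Rle_trans (_ : (2 * Rabs K * y <= _)%Re); last by apply: Rmult_le_compat_r; lra.
apply: Rle_trans Hz _; apply: Rle_trans (_ : (Rabs K * f + Rabs K <= _)%Re); last by nra.
by apply: Rplus_le_compat => //; apply: Rmult_le_compat_r.
Qed.

Lemma rp_subset_p (d eps : R) (k : error_kind) : (0 < eps)%Re ->
  (forall K : R, convertible k (bigO K (npow eps)) d) ->
  forall L, in_RP L -> in_P L.
Proof.
move=> eps0 conv L [a [M [K0 [NM [HK [Hh HL]]]]]].
have [wf [w0 wr wmin Hw]] := width_pred.
have [j Hj] := scale_bound K0.
have NMb n : NM n <= 2 ^ ((j + a) * wf n).
  apply/leP/INR_le; apply: Rle_trans (_ : (INR (2 ^ j) * INR (2 ^ (a * wf n)) <= _)%Re).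
    apply: (Hj (INR n ^ a)%Re) (HK n).
      split; first by apply: pow_le; apply: pos_INR.
      rewrite -INR_expn; apply: INR_leq; rewrite mulnC expnM.
      by case: (a) => [|a']; rewrite ?expn0 // leq_exp2r // ltnW // (Hw n).1.
    by apply: INR_ge1; rewrite expn_gt0.
  rewrite -INR_muln; apply: INR_leq; rewrite -expnD leq_exp2l // mulnDl leq_add2r.
  by rewrite leq_pmulr.
pose c := j + a + 2.
have lhs n : (maxn (maxn n.+1 (wf n)) (NM n).*2).+1 <= 2 ^ (c * wf n).
  have cE : 2 ^ (c * wf n) = 2 ^ ((j + a) * wf n) * 2 ^ wf n * 2 ^ wf n.
    by rewrite -!expnD; congr (2 ^ _); rewrite /c; lia.
  have H1 := (Hw n).1; have H2 : wf n < 2 ^ wf n by rewrite ltn_expl.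
  have H3 : 2 <= 2 ^ wf n by rewrite -{1}(expn1 2) leq_exp2l.
  have H4 : 0 < 2 ^ ((j + a) * wf n) by rewrite expn_gt0.
  rewrite cE; move: (wf n) (NM n) (2 ^ ((j + a) * wf n)) (2 ^ wf n) (NMb n) H1 H2 H3 H4.
  move=> w N A y NA ny wy y2 A0.
  have : maxn (maxn n.+1 w) N.*2 <= A * y.
    rewrite !geq_max; apply/andP; split; last by rewrite -mul2n mulnC leq_mul.
    rewrite (leq_trans ny) ?leq_pmull //.
    by rewrite (leq_trans (ltnW wy)) ?leq_pmull.
  by have : 0 < A * y by [rewrite muln_gt0 A0; lia]; move: (A * y) => B; nia.
(* For [rho >= c / eps], [N^eps] is at least [2^(c w)], which bounds the verification time; the
   summand [c] in [rho] gives [NM n < N], and the additive constant in [bigO] makes the time bound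
   strict. *)
have [r1 Hr1] := nat_above (INR c / eps).
pose rho := c + r1.
have [|||kappa [M' [Hd' Hh' HL']]] := @core (ceil_thinner 1) pred_thinner rho _ wf w0 wr wmin 1 _
    M NM (bigO 1 (npow eps)) L k d Hh (fun x => (HL x).1) (fun x => (HL x).2) _ (conv 1%Re).
- by case.
- by move=> n; rewrite mul1n; exact: (Hw n).1.
- move=> n N HN; have Hc : 2 ^ (c * wf n) <= N.
    by apply: leq_trans HN; rewrite leq_exp2l // leq_mul2r /rho leq_addr orbT.
  split.
    apply: leq_trans Hc; apply: leq_trans (lhs n); rewrite ltnS.
    by apply: leq_trans (leq_maxr _ _); rewrite -addnn leq_addr.
  apply: Rle_lt_trans (INR_leq (lhs n)) _; rewrite /bigO /npow.
  have HNR : (Rpower 2 (INR (rho * wf n)) <= INR N)%Re by rewrite -INR_pow2; exact: INR_leq.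
  have : (Rpower (Rpower 2 (INR (rho * wf n))) eps <= Rpower (INR N) eps)%Re.
    by apply: Rle_Rpower_l; [lra | split=> //; exact: exp_pos].
  rewrite Rpower_mult INR_pow2.
  have : (Rpower 2 (INR (c * wf n)) <= Rpower 2 (INR (rho * wf n) * eps))%Re.
    apply: Rle_Rpower; first by lra.
    rewrite !INR_muln /rho INR_addn.
    have Hc1 : (INR c <= INR r1 * eps)%Re.
      have -> : INR c = (INR c / eps * eps)%Re by field; lra.
      by apply: Rmult_le_compat_r => //; lra.
    have H1 := Rmult_le_compat_r _ _ _ (pos_INR (wf n)) Hc1.
    have H2 : (0 <= INR c * INR (wf n) * eps)%Re.
      apply: Rmult_le_pos; last by lra.
      by apply: Rmult_le_pos; exact: pos_INR.
    by lra.
  by lra.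
exists kappa, M', (INR (8 ^ kappa)), (fun n => 2 ^ (kappa * wf n)); split=> //; split=> // n.
have : 2 ^ (kappa * wf n) <= 8 ^ kappa * n ^ kappa + 8 ^ kappa.
  rewrite mulnC expnM.
  apply: leq_trans (_ : (4 * n.+1) ^ kappa <= _).
    by case: (kappa) => // k'; rewrite leq_exp2r // (Hw n).2.
  case: n => [|n].
    by apply: leq_trans (leq_addl _ _); case: (kappa) => // k'; rewrite leq_exp2r.
  apply: leq_trans (leq_addr _ _); rewrite -expnMn.
  by case: (kappa) => // k'; rewrite leq_exp2r //; lia.
by move/INR_leq; rewrite INR_addn INR_muln (INR_expn n) /bigO.
Qed.

Lemma Rpower_ge1 w beta : 0 < w -> (0 <= beta)%Re -> (1 <= Rpower (INR w) beta)%Re.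
Proof.
move=> w0 b0; rewrite -(Rpower_O (INR w)); last by have := INR_ge1 w0; lra.
by apply: Rle_Rpower => //; exact: INR_ge1.
Qed.

(** The last two claims differ only in the powers: [log N >= w], and [w] is a power of [n] for which
    [w^beta] covers both row length and running time. The factor [2 * J + 3] pays for two cell steps
    per machine step and for the loading step. *)
Lemma polylog_simulation p q (beta J : R) (M : PTM) NM T L k d :
  0 < p -> 0 < q -> (0 <= beta)%Re ->
  thalts_within M NM ->
  (forall x, (L x -> 2 ^ NM (size x) <= 2 * tacc_count M x (NM (size x))) /\
             (~ L x -> tacc_count M x (NM (size x)) = 0)) ->
  (forall n w, 0 < w -> n.+1 ^ p <= w ^ q ->
     (INR (maxn n.+1 w) <= Rpower (INR w) beta)%Re /\
     (INR (NM n) <= J * Rpower (INR w) beta)%Re) ->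
  (forall N w, 0 < w -> 2 ^ w <= N ->
     ((2 * J + 3) * Rpower (INR w) beta <= T N)%Re) ->
  convertible k T d ->
  exists (wf : nat -> nat) (kappa : nat) (M' : PTM),
  [/\ forall n, wf n ^ q <= 2 ^ (p * q) * n.+1 ^ p,
    deterministic M', thalts_within M' (fun n => 2 ^ (kappa * wf n))
    & forall x, L x <->
      cstate (trun M' x (fun _ => false) (2 ^ (kappa * wf (size x)))) = tqacc M'].
Proof.
move=> p0 q0 b0 Hh HL HB HT conv.
have [wf [w0 wr wmin Hw]] := width_floor p0 q0.
have [B HB1] := nat_above beta.
have [j Hj] := expn2_above J.
(* Chosen so that [NM n < 2^(rho w)]: the word then has enough cells for the simulated tapes. *)
pose rho := (B + j).+1.
have pow_bound n : (Rpower (INR (wf n)) beta <= INR (2 ^ (B * wf n)))%Re.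
  apply: Rle_trans (_ : (INR (wf n) ^ B <= _)%Re).
    rewrite -Rpower_pow; last by have := INR_ge1 (w0 n); lra.
    by apply: Rle_Rpower => //; exact: INR_ge1.
  rewrite -INR_expn; apply: INR_leq; rewrite mulnC expnM.
  by case: (B) => // B'; rewrite leq_exp2r // ltnW // ltn_expl.
have [|||kappa [M' [Hd' Hh' HL']]] := @core (ceil_thinner (2 ^ q).-1)
    (floor_thinner (2 ^ p).-1) rho _ wf w0 wr wmin q _
    M NM T L k d Hh (fun x => (HL x).1) (fun x => (HL x).2) _ conv.
- move=> b bp; rewrite /= ltn_Pdiv // prednK ?expn_gt0 //.
  by rewrite -{1}(expn0 2) ltn_exp2l.
- by move=> n; have [] := Hw n.
- move=> n N HN; have [Hpq _ _] := Hw n; have [H1 H2] := HB n (wf n) (w0 n) Hpq.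
  have P1 := Rpower_ge1 (w0 n) b0.
  have H3 := HT N (wf n) (w0 n).
  split.
    apply: leq_trans HN; apply: leq_ltn_trans (_ : 2 ^ ((B + j) * wf n) < _); last first.
      by rewrite ltn_exp2l // /rho mulSn -{1}[_ * _]add0n ltn_add2r.
    apply/leP/INR_le; apply: Rle_trans H2 _.
    apply: Rle_trans (_ : (INR (2 ^ j) * INR (2 ^ (B * wf n)) <= _)%Re).
      apply: Rle_trans (_ : (INR (2 ^ j) * Rpower (INR (wf n)) beta <= _)%Re).
        by apply: Rmult_le_compat_r => //; lra.
      by apply: Rmult_le_compat_l => //; exact: pos_INR.
    rewrite -INR_muln; apply: INR_leq; rewrite -expnD leq_exp2l // mulnDl addnC leq_add2l.
    by rewrite leq_pmulr.
  apply: Rlt_le_trans (H3 _); last first.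
    by apply: leq_trans HN; rewrite leq_exp2l // /rho mulSn leq_addr.
  have H4 : (INR (NM n).*2 <= 2 * J * Rpower (INR (wf n)) beta)%Re.
    by rewrite -addnn INR_addn; lra.
  rewrite S_INR; case: (leqP (maxn n.+1 (wf n)) (NM n).*2) => Hm.
    by lra.
  have J0 : (0 <= J * Rpower (INR (wf n)) beta)%Re by apply: Rle_trans H2; exact: pos_INR.
  by lra.
by exists wf, kappa, M'; split=> // n; have [] := Hw n.
Qed.

Lemma Rpow_le_inv (x y : R) n : 0 < n -> (0 <= y)%Re -> (x ^ n <= y ^ n)%Re -> (x <= y)%Re.
Proof.
move=> n0 y0 H; apply: Rnot_lt_le => lt.
suff : (y ^ n < x ^ n)%Re by lra.
case: n n0 {H} => // n _; elim: n => [|n IH]; first by rewrite !pow_1.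
have : (0 < x ^ n.+1)%Re by apply: pow_lt; lra.
by rewrite -![(_ ^ n.+2)%Re]/(_ * _ ^ n.+1)%Re; move: (x ^ n.+1)%Re (y ^ n.+1)%Re IH => A B H1 H0; nra.
Qed.

(** One factor [2^p] stems from the width, the other absorbs [n.+1 <= 2 * n]; at [n = 0] the power
    on the right is 1. *)
Lemma width_real p q n w : 0 < q -> w ^ q <= 2 ^ (p * q) * n.+1 ^ p ->
  (INR w <= INR (2 ^ (2 * p)) * npow (INR p / INR q) n)%Re.
Proof.
move=> q0 H.
have qR : (1 <= INR q)%Re by apply: INR_ge1.
have yq : ((npow (INR p / INR q) n) ^ q = if n is 0 then 1 else INR n ^ p)%Re.
  case: n H => [|n] _; first by rewrite npow0 pow1.
  have n0 : (0 < INR n.+1)%Re by apply: (INR_ltn (m := 0)).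
  rewrite /npow -Rpower_pow; last by apply: exp_pos.
  rewrite Rpower_mult (_ : (INR p / INR q * INR q)%Re = INR p) ?Rpower_pow //.
  by field; lra.
apply: (Rpow_le_inv q0).
  by apply: Rmult_le_pos; [exact: pos_INR | left; exact: exp_pos].
rewrite Rpow_mult_distr yq -!INR_expn.
apply: Rle_trans (INR_leq H) _; case: n {yq} H => [|n] _.
  rewrite Rmult_1_r; apply: INR_leq; rewrite exp1n muln1 -expnM leq_exp2l //.
  by rewrite leq_mul2r leq_pmull ?orbT.
rewrite -INR_muln; apply: INR_leq; rewrite -expnM.
apply: leq_trans (_ : 2 ^ (p * q) * (2 * n.+1) ^ p <= _).
  rewrite leq_mul2l; apply/orP; right.
  by case: (p) => // p'; rewrite leq_exp2r //; lia.
rewrite expnMn mulnA -expnD leq_mul2r; apply/orP; right.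
by rewrite leq_exp2l //; nia.
Qed.

Lemma npow_succ_bound (a : R) n : (0 <= a)%Re -> (npow a n <= Rpower (INR n.+1) a)%Re.
Proof.
move=> a0; case: n => [|n]; first by rewrite npow0; apply: Rpower_ge1.
apply: Rle_Rpower_l => //; split; first by apply: (INR_ltn (m := 0)).
by apply: INR_leq.
Qed.

Lemma rational_between (x y : R) : (0 < x)%Re -> (x < y)%Re ->
  exists p q, [/\ 0 < p, 0 < q, (x <= INR p / INR q)%Re & (INR p / INR q <= y)%Re].
Proof.
move=> x0 xy.
have [q1 Hq1] := nat_above (/ (y - x)).
pose q := q1.+1.
have qR : (0 < INR q)%Re by apply: (INR_ltn (m := 0)).
have Hq : (1 <= INR q * (y - x))%Re.
  have -> : 1%Re = (/ (y - x) * (y - x))%Re by field; lra.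
  apply: Rmult_le_compat_r; first by lra.
  by apply: Rle_trans Hq1 _; apply: INR_leq.
have xq0 : (0 < x * INR q)%Re by apply: Rmult_lt_0_compat.
have [u1 u2] := archimed (x * INR q).
have uz : (0 < up (x * INR q))%Z by apply: lt_IZR; lra.
exists (Z.to_nat (up (x * INR q))), q.
have pE : INR (Z.to_nat (up (x * INR q))) = IZR (up (x * INR q)).
  by rewrite INR_IZR_INZ Z2Nat.id //; lia.
rewrite pE; split=> //; first by lia.
  apply: (Rmult_le_reg_r (INR q)) => //.
  by rewrite /Rdiv Rmult_assoc Rinv_l; lra.
apply: (Rmult_le_reg_r (INR q)) => //.
by rewrite /Rdiv Rmult_assoc Rinv_l; lra.
Qed.

Lemma rtime_subexp (d : R) (k : error_kind) (b : R) : (2 < b)%Re ->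
  (forall K : R, convertible k (bigO K (fun n => Rpower (log2 n) b)) d) ->
  forall a c : R, (1 <= a)%Re -> (a / (b - 1) < c)%Re ->
  forall L, in_RTIME (npow a) L ->
    exists K : R, in_TIME (fun n => Rpower 2 (K * npow c n)) L.
Proof.
move=> b2 conv a c a1 ac L [M [K0 [NM [HK [Hh HL]]]]].
have x0 : (0 < a / b)%Re by apply: Rdiv_lt_0_compat; lra.
have xc : (a / b < c)%Re.
  apply: Rle_lt_trans ac; apply: Rmult_le_compat_l; first by lra.
  by apply: Rinv_le_contravar; lra.
(* From [a/b <= p/q] follows [n^a <= w^b], while [p/q <= c] bounds the width by [O(n^c)]; since
   [a/b < a/(b-1) < c], a rational fits between. *)
have [p [q [p0 q0 Hpq1 Hpq2]]] := rational_between x0 xc.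
have pR : (1 <= INR p)%Re by apply: INR_ge1.
have qR : (1 <= INR q)%Re by apply: INR_ge1.
have aqp : (INR q / INR p * a <= b)%Re.
  apply: (Rmult_le_reg_r (INR p / INR q / b)).
    by apply: Rdiv_lt_0_compat; [apply: Rdiv_lt_0_compat|]; lra.
  have -> : (INR q / INR p * a * (INR p / INR q / b) = a / b)%Re by field; lra.
  have -> : (b * (INR p / INR q / b) = INR p / INR q)%Re by field; lra.
  by [].
have [j Hj] := scale_bound K0.
have [|||wf [kappa [M' [Hw Hd' Hh' HL']]]] := @polylog_simulation p q b (INR (2 ^ j)) M NM
   (bigO (2 * INR (2 ^ j) + 3) (fun n => Rpower (log2 n) b)) L k d p0 q0 _ Hh HL _ _ (conv _).
- by lra.
- move=> n w w0 Hnw; have w1 := INR_ge1 w0.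
  have H1 : (Rpower (INR n.+1) a <= Rpower (INR w) b)%Re.
    apply: Rle_trans (_ : (Rpower (INR w) (INR q / INR p * a) <= _)%Re); last exact: Rle_Rpower.
    rewrite -Rpower_mult; apply: Rle_Rpower_l; first by lra.
    have n0 : (0 < INR n.+1)%Re by apply: (INR_ltn (m := 0)).
    split=> //; apply: (Rpow_le_inv p0); first by left; exact: exp_pos.
    rewrite -[X in (_ <= X)%Re]Rpower_pow; last exact: exp_pos.
    rewrite Rpower_mult (_ : (INR q / INR p * INR p)%Re = INR q); last by field; lra.
    rewrite Rpower_pow; last by lra.
    by rewrite -!INR_expn; exact: INR_leq.
  have n1 : (1 <= INR n.+1)%Re by apply: INR_ge1.
  split.
    case: (leqP n.+1 w) => Hm.
      rewrite -{1}(Rpower_1 (INR w)); last by lra.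
      by apply: Rle_Rpower => //; lra.
    apply: Rle_trans H1.
    by rewrite -{1}(Rpower_1 (INR n.+1)); [apply: Rle_Rpower | lra].
  apply: (Hj (npow a n)) (HK n); last by apply: Rpower_ge1 => //; lra.
  split; first by left; exact: exp_pos.
  by apply: Rle_trans H1; apply: npow_succ_bound; lra.
- move=> N w w0 HN; have Hl := log2_ge HN; have w1 := INR_ge1 w0.
  rewrite /bigO; have J0 := pos_INR (2 ^ j).
  have : (Rpower (INR w) b <= Rpower (log2 N) b)%Re by apply: Rle_Rpower_l; lra.
  move=> H; have := Rmult_le_compat_l (2 * INR (2 ^ j) + 3) _ _ _ H; lra.
exists (INR kappa * INR (2 ^ (2 * p)))%Re, M', 1%Re, (fun n => 2 ^ (kappa * wf n)).
split=> //; split=> // n; rewrite /bigO INR_pow2.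
suff : (Rpower 2 (INR (kappa * wf n)) <= Rpower 2 (INR kappa * INR (2 ^ (2 * p)) * npow c n))%Re by lra.
apply: Rle_Rpower; first by lra.
rewrite INR_muln Rmult_assoc; apply: Rmult_le_compat_l; first exact: pos_INR.
apply: Rle_trans (width_real q0 (Hw n)) _.
by apply: Rmult_le_compat_l; [exact: pos_INR | apply: npow_mono].
Qed.

Lemma rp_subexp (d : R) (k : error_kind) :
  (forall (b : nat) (K : R), convertible k (bigO K (fun n => log2 n ^ b)%Re) d) ->
  forall eps : R, (0 < eps)%Re ->
  forall L, in_RP L -> in_TIME (fun n => Rpower 2 (npow eps n)) L.
Proof.
move=> conv eps eps0 L [a [M [K0 [NM [HK [Hh HL]]]]]].
(* The target exponent [n^eps] has no constant factor, so the width is kept at order [n^(1/q)] with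
   [2/q <= eps], and squaring it absorbs the constant. *)
have [q1 Hq1] := nat_above (2 / eps); pose q := q1.+1.
have qR : (1 <= INR q)%Re by apply: INR_ge1.
have Hq : (2 / INR q <= eps)%Re.
  apply: (Rmult_le_reg_r (INR q)); first by lra.
  have -> : (2 / INR q * INR q = 2)%Re by field; lra.
  have -> : 2%Re = (eps * (2 / eps))%Re by field; lra.
  apply: Rmult_le_compat_l; first by lra.
  by apply: Rle_trans Hq1 _; apply: INR_leq.
have [j Hj] := scale_bound K0.
(* As [n < w^q], the power [w^(q a)] covers [n^a]; one more factor [w^q] covers the row length even
   for [a = 0]. *)
pose b := q * a.+1.
have [|||wf [kappa [M' [Hw Hd' Hh' HL']]]] := @polylog_simulation 1 q (INR b) (INR (2 ^ j)) M NM
   (bigO (2 * INR (2 ^ j) + 3) (fun n => log2 n ^ b)%Re) L k d isT isT _ Hh HL _ _ (conv b _).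
- exact: pos_INR.
- move=> n w w0 Hnw; have w1 := INR_ge1 w0; rewrite expn1 in Hnw.
  rewrite Rpower_pow; last by lra.
  rewrite -INR_expn; split.
    apply: INR_leq; rewrite geq_max; apply/andP; split.
      by apply: leq_trans Hnw _; rewrite leq_pexp2l // /b leq_pmulr.
    by rewrite -{1}(expn1 w) leq_pexp2l // /b.
  apply: (Hj (INR n ^ a)%Re) (HK n); last by apply: INR_ge1; rewrite expn_gt0 w0.
  split; first by apply: pow_le; apply: pos_INR.
  rewrite -INR_expn; apply: INR_leq; rewrite /b expnM.
  apply: leq_trans (_ : (w ^ q) ^ a <= _); last by rewrite leq_pexp2l // expn_gt0 w0.
  by case: (a) => // a'; rewrite leq_exp2r // ltnW.
- move=> N w w0 HN; have Hl := log2_ge HN; have w1 := INR_ge1 w0.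
  rewrite /bigO; have J0 := pos_INR (2 ^ j).
  rewrite Rpower_pow; last by lra.
  have : (INR w ^ b <= log2 N ^ b)%Re by apply: pow_incr; lra.
  move=> H; have := Rmult_le_compat_l (2 * INR (2 ^ j) + 3) _ _ _ H; lra.
pose C := (INR kappa * INR (2 ^ (2 * 1)))%Re.
exists M', (Rpower 2 (C * C)), (fun n => 2 ^ (kappa * wf n)).
split=> //; split=> // n; rewrite /bigO INR_pow2.
suff : (Rpower 2 (INR (kappa * wf n)) <= Rpower 2 (C * C) * Rpower 2 (npow eps n))%Re.
  have CC : (0 < Rpower 2 (C * C))%Re by exact: exp_pos.
  by lra.
rewrite -Rpower_plus; apply: Rle_Rpower; first by lra.
set y := npow (INR 1 / INR q) n.
have yy : (y * y <= npow eps n)%Re.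
  apply: Rle_trans (npow_mono n Hq).
  rewrite /y /npow -Rpower_plus; right; congr (Rpower _ _).
  by rewrite (_ : INR 1 = 1%Re) //; field; lra.
have : (INR (kappa * wf n) <= C * y)%Re.
  rewrite INR_muln /C Rmult_assoc; apply: Rmult_le_compat_l; first exact: pos_INR.
  by apply: width_real => //; exact: Hw.
(* AM-GM: [C y <= C^2 + y^2] *)
have := Rle_0_sqr (C - y); rewrite /Rsqr.
have : (0 <= y)%Re by left; exact: exp_pos.
have : (0 <= C)%Re by apply: Rmult_le_pos; exact: pos_INR.
nra.
Qed.

Theorem theorem2 (d : R) (hd : (1 <= d)%Re) (k : error_kind) :
  (* (1) *)
  ((exists eps : R, (0 < eps)%Re /\
      forall K : R, convertible k (bigO K (npow eps)) d) ->
   forall L : seq bool -> Prop, in_P L <-> in_RP L)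
  /\
  (* (2) *)
  ((forall (b : nat) (K : R), convertible k (bigO K (fun n => log2 n ^ b)%Re) d) ->
   forall eps : R, (0 < eps)%Re ->
   forall L : seq bool -> Prop, in_RP L ->
     in_TIME (fun n => Rpower 2 (npow eps n)) L)
  /\
  (* (3) *)
  (forall b : R, (2 < b)%Re ->
   (forall K : R, convertible k (bigO K (fun n => Rpower (log2 n) b)) d) ->
   forall a c : R, (1 <= a)%Re -> (a / (b - 1) < c)%Re ->
   forall L : seq bool -> Prop, in_RTIME (npow a) L ->
     exists K : R, in_TIME (fun n => Rpower 2 (K * npow c n)) L).
Proof.
split; [|split].
- move=> [eps [eps0 conv]] L; split; first exact: in_P_in_RP.
  exact: rp_subset_p eps0 conv L.
- exact: rp_subexp.
- by move=> b b2; exact: rtime_subexp.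
Qed.
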